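(* Let $M\ge3$, $N\ge 1$, $b_i=q^{\beta_i}$ ($1\le i\le M$), $c_k=q^{\gamma_k}$ ($1\le k\le N$), with $c_k/(b_{\sigma(i)}\cdots b_{\sigma(M)})\notin q^{\mathbb Z}$ for all $\sigma\in\mathfrak S_M$, $1\le i\le M+1$ and $1\le k\le N$. For each $1\le k\le N$ and $1\le r\le M-2$, the $M\times M$ matrices $\tilde S_r$ defined in the context satisfy the Yang--Baxter equation $$\tilde S_r\left(\begin{matrix}\{b_{s_{r+1}s_r(i)}\}_{1\le i\le M}\\ c_k\end{matrix};u\right)\tilde S_{r+1}\left(\begin{matrix}\{b_{s_r(i)}\}_{1\le i\le M}\\ c_k\end{matrix};uv\right)\tilde S_r\left(\begin{matrix}\{b_i\}_{1\le i\le M}\\ c_k\end{matrix};v\right)$$ $$=\tilde S_{r+1}\left(\begin{matrix}\{b_{s_rs_{r+1}(i)}\}_{1\le i\le M}\\ c_k\end{matrix};v\right)\tilde S_r\left(\begin{matrix}\{b_{s_{r+1}(i)}\}_{1\le i\le M}\\ c_k\end{matrix};uv\right)\tilde S_{r+1}\left(\begin{matrix}\{b_i\}_{1\le i\le M}\\ c_k\end{matrix};u\right),$$ where $u=t_{r+1}/t_{r+2}$, $v=t_r/t_{r+1}$, as an identity of meromorphic functions of $\log u,\log v$.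
   Context: Fix $q\in\mathbb C$, $0<|q|<1$, and a value of $\log q$. $(a)_\infty=\prod_{k\ge0}(1-aq^k)$, $(a,b)_\infty=(a)_\infty(b)_\infty$, $\theta(x)=(x,q/x)_\infty$, $q^{\mathbb Z}=\{q^n:n\in\mathbb Z\}$. A fraction $abc/defg$ means $(abc)/(defg)$; empty products are $1$ and empty sums are $0$. Powers are $w^\delta=e^{\delta\log w}$, with $\log(uv)=\log u+\log v$. $s_r=(r,r+1)\in\mathfrak S_M$, and products in $\mathfrak S_M$ are read from left to right: $(\sigma\tau)(i)=\tau(\sigma(i))$; thus $s_{r+1}s_r(i)=s_r(s_{r+1}(i))$ and $s_rs_{r+1}(i)=s_{r+1}(s_r(i))$. For $1\le r\le M-1$, $\tilde S_r\left(\begin{matrix}\{b_i\}_{1\le i\le M}\\ c_k\end{matrix};w\right)$ is the $M\times M$ block-diagonal matrix $$\mathrm{diag}\Big(I_{r-1},\begin{pmatrix}\tilde S_{r,r}&\tilde S_{r,r+1}\\ \tilde S_{r+1,r}&\tilde S_{r+1,r+1}\end{pmatrix},I_{M-r-1}\Big),$$ $$\tilde S_{r,r}=\frac{(q/b_{r+1},\,b_r)_\infty}{(q^2b_rb_{r+2}\cdots b_M/c_k,\,c_k/qb_{r+1}\cdots b_M)_\infty}\frac{\theta(wc_k/qb_{r+1}\cdots b_M)}{\theta(wb_r)}w^{-1-\sum_{i=r}^M\beta_i+\gamma_k},$$ $$\tilde S_{r,r+1}=\frac{(q^2b_{r+2}\cdots b_M/c_k,\,qb_r\cdots b_M/c_k)_\infty}{(q^2b_rb_{r+2}\cdots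 b_M/c_k,\,qb_{r+1}\cdots b_M/c_k)_\infty}\frac{\theta(w)}{\theta(wb_r)}w^{-\beta_r},$$ $$\tilde S_{r+1,r}=\frac{(c_k/b_r\cdots b_M,\,c_k/qb_{r+2}\cdots b_M)_\infty}{(c_k/b_rb_{r+2}\cdots b_M,\,c_k/qb_{r+1}\cdots b_M)_\infty}\frac{\theta(wb_r/b_{r+1})}{\theta(wb_r)}w^{-\beta_{r+1}},$$ $$\tilde S_{r+1,r+1}=\frac{(q/b_r,\,b_{r+1})_\infty}{(c_k/b_rb_{r+2}\cdots b_M,\,qb_{r+1}\cdots b_M/c_k)_\infty}\frac{\theta(wqb_rb_{r+2}\cdots b_M/c_k)}{\theta(wb_r)}w^{1+\sum_{i=r+2}^M\beta_i-\gamma_k}.$$ Here $I_n$ is the unit matrix. When the list $\{b_i\}$ is replaced by $\{b_{\sigma(i)}\}$, the $\beta_i$ are replaced by $\beta_{\sigma(i)}$ as well. *)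

(* Defs.v *)
From mathcomp Require Import all_boot all_order all_algebra all_fingroup.
From mathcomp Require Import complex.
From mathcomp Require Import all_classical all_reals all_analysis.
Set Implicit Arguments.
Unset Strict Implicit.
Unset Printing Implicit Defensive.
Import Order.TTheory GRing.Theory Num.Theory.
Import numFieldNormedType.Exports.
Local Open Scope classical_set_scope.
Local Open Scope ring_scope.

Section QCalculus.
Context {R : realType}.
Local Notation C := R[i].

Definition expC (z : C) : C :=
  (expR (complex.Re z))%:C%C *
  Complex (cos (complex.Im z)) (sin (complex.Im z)).

(* [powC lw d] is w^d for the determination [lw] of log w; since
   log (u v) = log u + log v, all functions of w below take [lw] as argument,
   and w itself is [expC lw]. *)
Definition powC (lw d : C) : C := expC (d * lw).

(* (a)_oo; [lim] is only meaningful when the partial products converge, which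
   they do for |q| < 1. *)
Definition qpoch (q a : C) : C :=
  lim ((fun n : nat => \prod_(0 <= k < n) (1 - a * q ^+ k) : C^o) @ \oo).

Definition qpoch2 (q a b : C) : C := qpoch q a * qpoch q b.

Definition qtheta (q x : C) : C := qpoch2 q x (q / x).

Definition qZ (q : C) : set C := [set x | exists n : int, x = q ^ n].

End QCalculus.

(* Positions 1, ..., M are represented by 'I_M, shifted down by one: a proof
   [hr : r.+1 < M] gives the two consecutive positions r and r.+1. *)
Section Matrices.
Context {R : realType} (M : nat).
Local Notation C := R[i].

(* The transposition exchanging positions r and r.+1. MathComp permutations
   satisfy (s * t) i = t (s i), i.e. products are read from left to right. *)
Definition adj_transp (r : nat) (hr : (r.+1 < M)%N) : 'S_M :=
  tperm (Ordinal (ltnW hr)) (Ordinal hr).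

Definition tail_prod (b : 'I_M -> C) (i : nat) : C :=
  \prod_(j < M | (i <= j)%N) b j.

Definition tail_sum (beta : 'I_M -> C) (i : nat) : C :=
  \sum_(j < M | (i <= j)%N) beta j.

(* The lists b, beta and the numbers c, gamma are meant to satisfy
   b i = q^(beta i) and c = q^gamma. *)
Section Stilde.
Variables (q : C) (b beta : 'I_M -> C) (c gamma : C).
Variables (r : nat) (hr : (r.+1 < M)%N) (lw : C).

Let w := expC lw.
Let r0 : 'I_M := Ordinal (ltnW hr).
Let r1 : 'I_M := Ordinal hr.
Let B := tail_prod b.

Definition Stilde00 : C :=
  qpoch2 q (q / b r1) (b r0)
  / qpoch2 q (q ^+ 2 * b r0 * B r.+2 / c) (c / (q * B r.+1))
  * (qtheta q (w * c / (q * B r.+1)) / qtheta q (w * b r0))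
  * powC lw (- 1 - tail_sum beta r + gamma).

Definition Stilde01 : C :=
  qpoch2 q (q ^+ 2 * B r.+2 / c) (q * B r / c)
  / qpoch2 q (q ^+ 2 * b r0 * B r.+2 / c) (q * B r.+1 / c)
  * (qtheta q w / qtheta q (w * b r0))
  * powC lw (- beta r0).

Definition Stilde10 : C :=
  qpoch2 q (c / B r) (c / (q * B r.+2))
  / qpoch2 q (c / (b r0 * B r.+2)) (c / (q * B r.+1))
  * (qtheta q (w * b r0 / b r1) / qtheta q (w * b r0))
  * powC lw (- beta r1).

Definition Stilde11 : C :=
  qpoch2 q (q / b r0) (b r1)
  / qpoch2 q (c / (b r0 * B r.+2)) (q * B r.+1 / c)
  * (qtheta q (w * q * b r0 * B r.+2 / c) / qtheta q (w * b r0))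
  * powC lw (1 + tail_sum beta r.+2 - gamma).

Definition Stilde : 'M[C]_M :=
  \matrix_(i, j)
    if (i == r0) && (j == r0) then Stilde00
    else if (i == r0) && (j == r1) then Stilde01
    else if (i == r1) && (j == r0) then Stilde10
    else if (i == r1) && (j == r1) then Stilde11
    else (i == j)%:R.

End Stilde.
End Matrices.

(* Main.v *)
Require Import Defs.
From mathcomp Require Import all_boot all_order all_algebra all_fingroup.
From mathcomp Require Import complex.
From mathcomp Require Import all_classical all_reals all_analysis.
From mathcomp Require Import ring lra zify.
Import Order.TTheory GRing.Theory Num.Theory.
Import numFieldNormedType.Exports ComplexField.Normc.
Local Open Scope classical_set_scope.
Local Open Scope ring_scope.

Set Implicit Arguments.
Unset Strict Implicit.
Unset Printing Implicit Defensive.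

(** After conjugation by the diagonal matrices with entries
    [(q B_i / c)_oo / (q^2 B_(i+1) / c)_oo], where [B_i = b_i ... b_M], the entries
    of the matrices become theta quotients times Pochhammer factors [(q/b)(a)] and
    powers of [w].  The powers and the Pochhammer factors cancel (or recombine into
    [theta(b)]) entry by entry, and each of the nine scalar identities left is an
    instance, or in one case the combination of two instances, of the three-term
    relation of Weierstrass for [theta].

    The three-term relation is the Pluecker relation for 2x2 minors, because
    [theta(xy) theta(x/y)] has rank two: up to a constant it is
    [x (o(x) e(y) - e(x) o(y))] with [e(x) = sum q^(i^2) x^(2i)] and
    [o(x) = sum q^(i^2+i) x^(2i+1)].  This comes from splitting the product of two
    Jacobi triple product series according to the parity of [m - n]; it is obtained
    as a limit from the finite triple product (the q-binomial theorem) by dominated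
    convergence over pairs of integers. *)

(** * The finite Jacobi triple product *)

(** Theta is given as a limit of partial products, so the three-term relation is not reached by
    comparing zeros and poles. The exact part happens at finite level: cut off at N, the sums e and
    o satisfy the Pluecker relation identically, and they need no limits of their own; only their
    minors are shown to converge. The obstacle is that the two finite expansions of theta(xy)
    theta(x/y) live on different index sets: the product of two finite triple products fills a
    square of pairs (m, n), the parity splitting fills a diamond. A limit theorem for sums over
    varying finite sets bridges the two. The gauge factors depend on the list b, and each matrix
    leads from one list to the list with two neighbours exchanged. Rows are therefore scaled with
    the exchanged list and columns with the original one. Consecutive factors of a product share a
    list, so the inner gauge factors cancel, and both sides of the equation keep those of the same
    first and last list. *)

Section FiniteTripleProduct.
Variable K : fieldType.
Variable q : K.

Definition qprod (a : K) (n : nat) : K := \prod_(0 <= k < n) (1 - a * q ^+ k).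

Lemma qprodS a n : qprod a n.+1 = qprod a n * (1 - a * q ^+ n).
Proof. by rewrite /qprod big_nat_recr. Qed.

Lemma qprodSl a n : qprod a n.+1 = (1 - a) * qprod (a * q) n.
Proof.
rewrite /qprod big_nat_recl // expr0 mulr1; congr (_ * _).
by apply: eq_bigr => k _; rewrite exprS mulrA.
Qed.

Lemma qprodD a m n : qprod a (m + n) = qprod a m * qprod (a * q ^+ m) n.
Proof.
elim: m a => [|m IH] a; first by rewrite add0n {2}/qprod big_geq // mul1r expr0 mulr1.
by rewrite addSn !qprodSl IH exprS (mulrA a) mulrA.
Qed.

(** The Gaussian binomial coefficient, by the Pascal rule that results from multiplying by a last
    factor [1 - x * q ^+ n]. Where [n' - k'] is truncated, its term vanishes. *)
Fixpoint qbinom (n k : nat) : K :=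
  match n, k with
  | _, 0%N => 1
  | 0%N, _.+1 => 0
  | n'.+1, k'.+1 => qbinom n' k'.+1 + q ^+ (n' - k') * qbinom n' k'
  end.

Lemma qbinom_small n k : (n < k)%N -> qbinom n k = 0.
Proof.
elim: n k => [|n IH] [|k] //= nk; rewrite ltnS in nk.
by rewrite !IH ?mulr0 ?addr0 // ltnW.
Qed.

Lemma qbinomnn n : qbinom n n = 1.
Proof.
by elim: n => [|n IH] //=; rewrite IH qbinom_small // subnn expr0 mul1r add0r.
Qed.

Lemma qbinom0 n : qbinom n 0 = 1.
Proof. by case: n. Qed.

(** The usual quotient of q-factorials, kept free of division. The Pascal rule reproduces it because
    (1 - q^(j+1)) + q^(j+1) (1 - q^(k+1)) = 1 - q^(k+j+2). *)
Lemma qbinom_qprod n k j : (k + j)%N = n ->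
  qbinom n k * (qprod q k * qprod q j) = qprod q n.
Proof.
have q00 : qprod q 0 = 1 by rewrite /qprod big_geq.
elim: n k j => [|n IH] [|k] [|j] // Hn.
- by rewrite q00 !mulr1.
- by rewrite -Hn add0n qbinom0 q00 !mul1r.
- by rewrite -Hn addn0 qbinomnn q00 mulr1 mul1r.
have H1 : (k.+1 + j)%N = n by lia.
have H2 : (k + j.+1)%N = n by lia.
have -> : qbinom n.+1 k.+1 = qbinom n k.+1 + q ^+ j.+1 * qbinom n k.
  by rewrite /= (_ : (n - k = j.+1)%N) //; lia.
rewrite mulrDl [X in X + _](_ : _ =
  qbinom n k.+1 * (qprod q k.+1 * qprod q j) * (1 - q * q ^+ j)); last first.
  by rewrite (qprodS q j); ring.
rewrite (IH _ _ H1) [X in _ + X](_ : _ = q ^+ j.+1 *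
  (qbinom n k * (qprod q k * qprod q j.+1)) * (1 - q * q ^+ k)); last first.
  by rewrite (qprodS q k); ring.
by rewrite (IH _ _ H2) (qprodS q n) -[in q ^+ n]H2 !exprS exprD exprS; ring.
Qed.

Hypothesis q0 : q != 0.

Variable p : K.
Hypothesis pq : p ^+ 2 = q.

Let p0 : p != 0.
Proof. by apply: contra_neq q0 => p0; rewrite -pq p0 expr0n. Qed.

Lemma exprz2 (m : int) : q ^ m = p ^ (2 * m).
Proof. by rewrite -pq -exprz_exp. Qed.

(* With [p^2 = q] the exponent m (m - 1) / 2 of [q] needs no halving. *)
Definition jterm (x : K) (m : int) : K := (-1) ^ m * p ^ (m * m - m) * x ^ m.

Lemma jtermS (x : K) m : x != 0 -> jterm x (m + 1) = - (x * q ^ m) * jterm x m.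
Proof.
move=> x0; rewrite /jterm !(expfzDr m 1) ?oppr_eq0 ?oner_eq0 //.
rewrite (_ : (m + 1) * (m + 1) - (m + 1) = (m * m - m) + 2 * m); last by ring.
rewrite expfzDr // exprz2 !expr1z; ring.
Qed.

Lemma jterm0 x : jterm x 0 = 1.
Proof. by rewrite /jterm mulr0 subr0 !expr0z !mulr1. Qed.

Lemma qbinomial_theorem (x : K) n : x != 0 ->
  qprod x n = \sum_(i < n.+1) qbinom n i * jterm x i.
Proof.
move=> x0; elim: n => [|n IH].
  by rewrite big_ord1 /qprod big_geq // jterm0 mulr1.
rewrite qprodS mulrBr mulr1 IH [RHS]big_ord_recl /= mul1r jterm0.
under [in RHS]eq_bigr => i _.
  rewrite /bump leq0n !add1n /= mulrDl; over.
rewrite big_split /= addrA; congr (_ + _).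
  rewrite [in RHS]big_ord_recr /= (qbinom_small (ltnSn n)) mul0r addr0.
  rewrite [LHS]big_ord_recl qbinom0 jterm0 mul1r; congr (_ + _).
rewrite -mulrN mulr_suml; apply: eq_bigr => i _.
case: i => i /=; rewrite ltnS !add0n => ni.
rewrite -(addn1 i) PoszD jtermS // -[q ^ i%:Z]/(q ^+ i).
have -> : q ^+ n = q ^+ (n - i) * q ^+ i by rewrite -exprD subnK.
by ring.
Qed.

(** Completing the square: m^2 - m - 2Nm = (m-N)^2 - (m-N) - (N^2+N). This recentres the q-binomial
    theorem from 0, ..., 2N to -N, ..., N. *)
Lemma jterm_shift (x : K) (N : nat) (m : int) : x != 0 ->
  jterm (x / q ^+ N) m
  = (- x) ^+ N / p ^+ (N * N + N) * jterm x (m - N%:Z).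
Proof.
move=> x0; have n10 : (-1 : K) != 0 by rewrite oppr_eq0 oner_eq0.
rewrite -[q ^+ N]/(q ^ N%:Z) exprz2 -[p ^+ _]/(p ^ (N * N + N)%N%:Z) !invr_expz.
rewrite exprNn -[_ ^+ N]/((-1 : K) ^ N%:Z) -[x ^+ N]/(x ^ N%:Z).
rewrite /jterm expfzMl exprz_exp.
rewrite [RHS](_ : _ = ((-1) ^ N%:Z * (-1) ^ (m - N%:Z)) *
   (p ^ (- (N * N + N)%N%:Z) * p ^ ((m - N%:Z) * (m - N%:Z) - (m - N%:Z))) *
   (x ^ N%:Z * x ^ (m - N%:Z))); last by ring.
rewrite -(expfzDr _ _ n10) -(expfzDr _ _ p0) -(expfzDr _ _ x0).
have -> : (N%:Z + (m - N%:Z)) = m by ring.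
rewrite [x ^ m * _]mulrC mulrA; congr (_ * _); rewrite -mulrA; congr (_ * _).
rewrite -(expfzDr _ _ p0); congr (p ^ _).
by rewrite PoszD PoszM; ring.
Qed.

(** Each factor is turned round, 1 - x q^(-j) = - x q^(-j) (1 - q^j / x) for 1 <= j <= N, and the
    powers of [q] multiply to p^(-(N^2+N)). *)
Lemma qprod_shift (x : K) N : x != 0 ->
  qprod (x / q ^+ N) N = (- x) ^+ N / p ^+ (N * N + N) * qprod (q / x) N.
Proof.
move=> x0; elim: N => [|N IH].
  by rewrite /qprod !big_geq // !expr0 invr1 !mulr1.
have qN0 : q ^+ N != 0 by rewrite expf_neq0.
rewrite qprodSl [x / _ * q](_ : _ = x / q ^+ N); last first.
  by rewrite exprS; field; rewrite qN0 q0.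
rewrite IH qprodS (_ : N.+1 * N.+1 + N.+1 = (N * N + N) + 2 * N.+1)%N; last by lia.
rewrite (exprD p (N * N + N)) (exprM p 2) pq !(exprS _ N).
by field; rewrite qN0 q0 x0 expf_neq0.
Qed.

(** This is the q-binomial theorem for the 2N factors starting at [x / q ^+ N]; [qprod_shift] and
    [jterm_shift] produce the same constant, which cancels. *)
Lemma finite_jacobi_triple (x : K) N : x != 0 ->
  qprod x N * qprod (q / x) N
  = \sum_(i < (N + N).+1) qbinom (N + N) i * jterm x (i%:Z - N%:Z).
Proof.
move=> x0.
have qN0 : q ^+ N != 0 by rewrite expf_neq0.
have A0 : (- x) ^+ N / p ^+ (N * N + N) != 0.
  by rewrite mulf_neq0 ?invr_eq0 ?expf_neq0 ?oppr_eq0.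
apply: (mulfI A0); rewrite mulrCA mulrA -mulrA mulrC -qprod_shift //.
have -> : qprod x N = qprod (x / q ^+ N * q ^+ N) N by rewrite mulfVK.
rewrite [RHS]mulr_sumr; under [RHS]eq_bigr => i _ do
  rewrite mulrCA -jterm_shift //.
rewrite -qbinomial_theorem ?mulf_neq0 ?invr_eq0 // qprodD.
by rewrite mulrC.
Qed.

Lemma jterm_pair (x y : K) (m n : int) : x != 0 -> y != 0 ->
  jterm (x * y) m * jterm (x / y) n =
  (-1) ^ (m + n) * p ^ (m * m - m + (n * n - n)) * x ^ (m + n) * y ^ (m - n).
Proof.
move=> x0 y0; have n10 : (-1 : K) != 0 by rewrite oppr_eq0 oner_eq0.
by rewrite /jterm !expfzMl !expfzDr // !exprz_inv; ring.
Qed.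

Lemma exprN1z_even (k : int) : (-1 : K) ^ (2 * k) = 1.
Proof.
by rewrite -exprz_exp -[(-1) ^ 2%:Z]/((-1) ^+ 2) sqrrN expr1n exp1rz.
Qed.

Definition eterm (x : K) (i : int) : K := p ^ (2 * (i * i)) * x ^ (2 * i).
Definition oterm (x : K) (i : int) : K := p ^ (2 * (i * i + i)) * x ^ (2 * i + 1).

(** The exponent m^2 - m + n^2 - n separates in the variables m + n and m - n, so for a fixed parity
    of m - n the product of two terms splits into a function of [i] and one of [j]. *)
Lemma jterm_even (x y : K) (i j : int) : x != 0 -> y != 0 ->
  jterm (x * y) (i + j + 1) * jterm (x / y) (i - j + 1)
  = x * (oterm x i * eterm y j).
Proof.
move=> x0 y0; rewrite jterm_pair //.
have -> : i + j + 1 + (i - j + 1) = 2 * (i + 1) by ring.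
rewrite exprN1z_even mul1r.
have -> : i + j + 1 - (i - j + 1) = 2 * j by ring.
have -> : (i + j + 1) * (i + j + 1) - (i + j + 1) +
  ((i - j + 1) * (i - j + 1) - (i - j + 1)) = 2 * (i * i + i) + 2 * (j * j) by ring.
have -> : 2 * (i + 1) = 1 + (2 * i + 1) by ring.
by rewrite (expfzDr _ _ p0) (expfzDr 1 _ x0) expr1z /oterm /eterm; ring.
Qed.

Lemma jterm_odd (x y : K) (i j : int) : x != 0 -> y != 0 ->
  jterm (x * y) (i + j + 1) * jterm (x / y) (i - j)
  = - (x * (eterm x i * oterm y j)).
Proof.
move=> x0 y0; rewrite jterm_pair //.
have -> : i + j + 1 + (i - j) = 1 + 2 * i by ring.
have n10 : (-1 : K) != 0 by rewrite oppr_eq0 oner_eq0.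
rewrite (expfzDr 1 _ n10) exprN1z_even expr1z mulr1.
have -> : i + j + 1 - (i - j) = 2 * j + 1 by ring.
have -> : (i + j + 1) * (i + j + 1) - (i + j + 1) +
  ((i - j) * (i - j) - (i - j)) = 2 * (i * i) + 2 * (j * j + j) by ring.
by rewrite (expfzDr _ _ p0) (expfzDr 1 _ x0) expr1z /oterm /eterm; ring.
Qed.

End FiniteTripleProduct.

(** * Sequences of complex numbers *)

Section ComplexSequences.
Context {R : realType}.
Local Notation C := R[i].

Local Notation cvgc u l := ((u : nat -> C^o) @ \oo --> (l : C^o)).

Lemma normcE0 (z : C) : `|z| = (normc z)%:C%C.
Proof. by []. Qed.

Lemma normc_ge0 (z : C) : 0 <= normc z.
Proof. by case: z => a b; exact: sqrtr_ge0. Qed.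

Lemma normcB (x y : C) : normc (x - y) = normc (y - x).
Proof. by rewrite -normcN opprB. Qed.

Lemma normc_prod (I : Type) (s : seq I) (F : I -> C) :
  normc (\prod_(i <- s) F i) = \prod_(i <- s) normc (F i).
Proof. exact: (big_morph _ (@normcM R) (@normc1 R)). Qed.

Lemma normc_sum (I : Type) (s : seq I) (F : I -> C) :
  normc (\sum_(i <- s) F i) <= \sum_(i <- s) normc (F i).
Proof.
elim/big_ind2: _ => [|x a y b xa yb|//]; first by rewrite normc0.
by apply: le_trans (le_normcD _ _) _; exact: lerD.
Qed.

Lemma normcX (z : C) n : normc (z ^+ n) = normc z ^+ n.
Proof. by elim: n => [|n IH]; rewrite ?normc1 // !exprS normcM IH. Qed.

(** The norm of [C] is complex valued, so its balls have complex radii. A positive complex number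
    has zero imaginary part, which permits real radii and [normc]. *)
Lemma cvg_normcP (u : nat -> C) (l : C) :
  cvgc u l <->
  (forall e : R, 0 < e ->
    exists N, forall n, (N <= n)%N -> normc (u n - l) < e).
Proof.
split=> [ul e e0|ul].
  have e0' : 0 < e%:C%C by rewrite ltcR.
  have [N _ H] := (@cvgrPdist_lt _ _ _ _ _ _ _).1 ul _ e0'.
  by exists N => n /H /=; rewrite normcE0 ltcR normcB.
apply/(@cvgrPdist_lt _ C^o) => e; rewrite ltcE /= => /andP[/eqP e0 ee].
have [N H] := ul _ ee.
exists N => // n /H /=; rewrite normcB => {}H.
by rewrite normcE0 ltcE /= e0 eqxx.
Qed.

Lemma cvg_distP (u : nat -> R) (l : R) :
  (u @ \oo --> l) <->
  (forall e : R, 0 < e ->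
    exists N, forall n, (N <= n)%N -> `|u n - l| < e).
Proof.
split=> [/cvgrPdist_lt ul e e0|ul].
  by have [N _ H] := ul e e0; exists N => n /H /=; rewrite distrC.
apply/cvgrPdist_lt => e e0; have [N H] := ul _ e0.
by exists N => // n /H /=; rewrite distrC.
Qed.

Lemma cvgC_ReIm (u : nat -> C) (a b : R) :
  (fun n => complex.Re (u n)) @ \oo --> a ->
  (fun n => complex.Im (u n)) @ \oo --> b ->
  cvgc u (Complex a b).
Proof.
move=> /cvg_distP ua /cvg_distP ub; apply/cvg_normcP => e e0.
have e20 : 0 < e / 2 by rewrite divr_gt0.
have [N1 H1] := ua _ e20; have [N2 H2] := ub _ e20.
exists (maxn N1 N2) => n; rewrite geq_max => /andP[/H1 Ha /H2 Hb].
have E : u n - Complex a b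
    = (complex.Re (u n) - a)%:C%C + 'i%C * (complex.Im (u n) - b)%:C%C.
  by case: (u n) => c d; simpc.
rewrite E; apply: le_lt_trans (le_normcD _ _) _.
rewrite normcM /= !expr0n /= ?addr0 ?add0r expr1n sqrtr1 mul1r !sqrtr_sqr.
by lra.
Qed.

Lemma normc_ReIm (z : C) :
  `|complex.Re z| <= normc z /\ `|complex.Im z| <= normc z.
Proof.
case: z => a b /=; split; rewrite -sqrtr_sqr; apply: ler_wsqrtr.
  by rewrite lerDl sqr_ge0.
by rewrite lerDr sqr_ge0.
Qed.

(** Completeness is used in [R] only: the real and imaginary parts inherit the bound on the
    increments and are sums of absolutely convergent series. *)
Lemma geometric_increments_cvg (u : nat -> C) (K r : R) :
  0 <= r < 1 -> (forall n, normc (u n.+1 - u n) <= K * r ^+ n) ->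
  exists l : C, cvgc u l.
Proof.
move=> /andP[r0 r1] H.
have main (v : nat -> R) : (forall n, `|v n.+1 - v n| <= K * r ^+ n) ->
    exists l : R, v @ \oo --> l.
  move=> Hv.
  have cs : cvgn (series (fun n => v n.+1 - v n)).
    apply: normed_cvg.
    apply: (@series_le_cvg _ _ (geometric K r)) => [n|n|n|].
    - exact: normr_ge0.
    - exact: le_trans (normr_ge0 _) (Hv n).
    - exact: Hv.
    - by apply: is_cvg_geometric_series; rewrite ger0_norm.
  exists (v 0 + limn (series (fun n => v n.+1 - v n))).
  have E : v = (fun n => v 0 + series (fun n => v n.+1 - v n) n).
    by apply/funext => n; rewrite /series /= telescope_sumr // addrC subrK.
  rewrite [X in X @ _]E.
  exact: (cvgD (cvg_cst (v 0)) cs).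
have [a ua] : exists a : R, (fun n => complex.Re (u n)) @ \oo --> a.
  apply: (main (fun n => complex.Re (u n))) => n.
  rewrite -raddfB; apply: le_trans (H n).
  by have [] := normc_ReIm (u n.+1 - u n).
have [b ub] : exists b : R, (fun n => complex.Im (u n)) @ \oo --> b.
  apply: (main (fun n => complex.Im (u n))) => n.
  rewrite -raddfB; apply: le_trans (H n).
  by have [] := normc_ReIm (u n.+1 - u n).
exists (Complex a b); exact: cvgC_ReIm.
Qed.

End ComplexSequences.

(** * The infinite q-Pochhammer symbol *)

Section QPochhammer.
Context {R : realType}.
Local Notation C := R[i].
Local Notation cvgc u l := ((u : nat -> C^o) @ \oo --> (l : C^o)).
Variable q : C.
Hypothesis q1 : normc q < 1.

Lemma sum_normq n : \sum_(0 <= k < n) normc q ^+ k <= (1 - normc q)^-1.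
Proof.
have q0 : 0 < 1 - normc q by rewrite subr_gt0.
have -> : \sum_(0 <= k < n) normc q ^+ k = (1 - normc q ^+ n) / (1 - normc q).
  apply: (canRL (mulfK (lt0r_neq0 q0))); elim: n => [|n IH].
    by rewrite big_geq // mul0r expr0 subrr.
  by rewrite big_nat_recr //= mulrDl IH exprS; ring.
by rewrite ler_pdivrMr // mulVf ?gt_eqF // gerBl exprn_ge0 // normc_ge0.
Qed.

(** Factorwise |1 - a q^k| <= 1 + |a| |q|^k <= exp(|a| |q|^k), and the exponents add up to at most
    |a| / (1 - |q|). *)
Lemma qprod_bounded (a : C) : exists2 K, 0 <= K & forall n, normc (qprod q a n) <= K.
Proof.
exists (expR (normc a / (1 - normc q))) => [|n]; first exact: expR_ge0.
rewrite /qprod normc_prod.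
apply: (@le_trans _ _ (\prod_(0 <= k < n) expR (normc a * normc q ^+ k))).
  apply: ler_prod => k _; rewrite normc_ge0 /=.
  apply: le_trans (expR_ge1Dx _).
  by apply: le_trans (le_normcD _ _) _; rewrite normc1 normcN normcM normcX.
rewrite -expR_sum ler_expR -mulr_sumr ler_wpM2l ?normc_ge0 //.
exact: sum_normq.
Qed.

(** Consecutive partial products differ by (a)_n a q^n, so their boundedness makes the increments
    geometric. *)
Lemma qprod_cvg (a : C) : cvgc (qprod q a) (qpoch q a).
Proof.
have [K K0 HK] := qprod_bounded a.
have [l Hl] : exists l : C, cvgc (qprod q a) l.
  apply: (@geometric_increments_cvg _ _ (K * normc a) (normc q)).
    by rewrite normc_ge0 q1.
  move=> n; rewrite qprodS mulrBr mulr1 addrAC subrr sub0r normcN !normcM.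
  by rewrite normcX mulrA !ler_wpM2r ?exprn_ge0 ?normc_ge0.
by rewrite /qpoch (cvg_lim _ Hl) //; exact: norm_hausdorff.
Qed.

Lemma cvgc_unique (u : nat -> C) (l m : C) : cvgc u l -> cvgc u m -> l = m.
Proof. by move=> ul um; exact: (@cvg_unique _ (@norm_hausdorff _ C^o) _ _ _ _ ul um).
  Qed.

Lemma cvgcM (u v : nat -> C) (l m : C) :
  cvgc u l -> cvgc v m -> cvgc (fun n => u n * v n) (l * m).
Proof. by move=> ul vm; exact: (@cvgM C _ _ _ u v l m ul vm). Qed.

Lemma cvgcZ (u : nat -> C) (a l : C) :
  cvgc u l -> cvgc (fun n => a * u n) (a * l).
Proof. by move=> ul; exact: (cvgcM (cvg_cst (a : C^o)) ul). Qed.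

Lemma cvgc_shift k (u : nat -> C) (l : C) :
  cvgc u l <-> cvgc (fun n => u (n + k)%N) l.
Proof. by rewrite (@cvg_shiftn k C^o u (nbhs (l : C^o))). Qed.

Lemma qpoch_split (a : C) m : qpoch q a = qprod q a m * qpoch q (a * q ^+ m).
Proof.
apply: (@cvgc_unique (fun n => qprod q a (n + m))).
  exact/(cvgc_shift m (qprod q a))/qprod_cvg.
have -> : (fun n => qprod q a (n + m)) = fun n => qprod q a m * qprod q (a * q ^+ m) n.
  by apply/funext => n; rewrite addnC qprodD.
exact/cvgcZ/qprod_cvg.
Qed.

Lemma qpoch_rec (a : C) : qpoch q a = (1 - a) * qpoch q (a * q).
Proof.
by rewrite (qpoch_split a 1) /qprod big_nat1 expr0 expr1 mulr1.
Qed.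

(** A product of nonzero factors could still tend to 0. Finitely many factors are split off until |a
    q^m| / (1 - |q|) <= 1/2; on the tail, prod (1 - t_k) >= 1 - sum t_k keeps every partial product
    at least 1/2 in norm. *)
Lemma qpoch_neq0 (a : C) : (forall k : nat, a * q ^+ k != 1) -> qpoch q a != 0.
Proof.
move=> Ha; have q0 : 0 < 1 - normc q by rewrite subr_gt0.
have [m Hm] : exists m, normc (a * q ^+ m) / (1 - normc q) <= 2^-1.
  have := @cvg_geometric R (normc a / (1 - normc q)) (normc q).
  rewrite ger0_norm ?normc_ge0 // => /(_ q1)/cvg_distP/(_ 2^-1) [|m Hm].
    by rewrite invr_gt0.
  exists m; have := Hm m (leqnn m); rewrite subr0 => /ltW.
  move/(le_trans (ler_norm _)); rewrite /geometric /= normcM normcX.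
  by rewrite mulrAC.
rewrite (qpoch_split a m) mulf_neq0 //.
  by rewrite prodf_seq_neq0; apply/allP => k _ /=; rewrite subr_eq0 eq_sym.
move: (a * q ^+ m) Hm => b Hm.
have low n : 2^-1 <= normc (qprod q b n).
  suff H : 1 - normc b * \sum_(0 <= k < n) normc q ^+ k <= normc (qprod q b n).
    apply: le_trans H; have := ler_wpM2l (normc_ge0 b) (sum_normq n).
    by move: Hm; set x := _ / _; set y := _ * _; lra.
  have bh : normc b <= 2^-1.
    apply: le_trans Hm; rewrite ler_pdivlMr // ler_piMr ?normc_ge0 //.
    by rewrite gerBl normc_ge0.
  elim: n => [|n IH].
    by rewrite big_geq // mulr0 subr0 /qprod big_geq // normc1.
  rewrite big_nat_recr //= qprodS normcM.
  set S := \sum_(0 <= k < n) _ in IH *; set x := normc q ^+ n.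
  have x0 : 0 <= x by rewrite exprn_ge0 ?normc_ge0.
  have x1 : x <= 1 by rewrite exprn_ile1 ?normc_ge0 // ltW.
  have S0 : 0 <= S by apply: sumr_ge0 => k _; rewrite exprn_ge0 ?normc_ge0.
  have bx : normc b * x <= 1.
    by apply: mulr_ile1; rewrite ?normc_ge0 //; lra.
  have lowx : 1 - normc b * x <= normc (1 - b * q ^+ n).
    have := le_normcD (1 - b * q ^+ n) (b * q ^+ n).
    by rewrite subrK normc1 normcM normcX -/x; lra.
  apply: (@le_trans _ _ ((1 - normc b * S) * (1 - normc b * x))).
    rewrite -subr_ge0.
    rewrite (_ : _ - _ = normc b * S * (normc b * x)); last by ring.
    by rewrite !mulr_ge0 ?normc_ge0.
  apply: (@le_trans _ _ (normc (qprod q b n) * (1 - normc b * x))).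
    by rewrite ler_wpM2r // subr_ge0.
  by rewrite ler_wpM2l ?normc_ge0.
apply/eqP => b0; have := @qprod_cvg b; rewrite b0 => /cvg_normcP/(_ 2^-1) [|N HN].
  by rewrite invr_gt0.
have := HN N (leqnn N); rewrite subr0 => /lt_le_trans/(_ (low N)).
by rewrite ltxx.
Qed.

End QPochhammer.

(** * Dominated convergence of finite sums *)

Section DominatedConvergence.
Context {R : realType}.
Local Notation C := R[i].
Local Notation cvgc u l := ((u : nat -> C^o) @ \oo --> (l : C^o)).

Lemma ler_sum_uniq_sub (I : eqType) (s t : seq I) (f : I -> R) :
  uniq s -> uniq t -> {subset s <= t} -> (forall i, 0 <= f i) ->
  \sum_(i <- s) f i <= \sum_(i <- t) f i.
Proof.
move=> us ut st f0; rewrite [leRHS](bigID (mem s)) /=.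
rewrite -[X in _ <= X + _]big_filter [X in _ <= X + _](perm_big s) /=; last first.
  apply: uniq_perm; rewrite ?filter_uniq // => i; rewrite mem_filter.
  by case: (boolP (i \in s)) => // /st ->.
by rewrite lerDl sumr_ge0.
Qed.

(** Dominated convergence with bounded coefficients that tend to 0 one by one. The index type has no
    order, so the supremum of the finite sums takes the place of a series. *)
Lemma tannery (I : eqType) (f : I -> C) (S K : R) (g : nat -> I -> C)
    (A : nat -> seq I) :
  (forall s, uniq s -> \sum_(i <- s) normc (f i) <= S) ->
  (forall n i, normc (g n i) <= K) ->
  (forall i, cvgc (fun n => g n i) 0) ->
  (forall n, uniq (A n)) ->
  cvgc (fun n => \sum_(i <- A n) g n i * f i) 0.
Proof.
move=> fS gK g0 uA; apply/cvg_normcP => e e0.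
pose K' := `|K| + 1; have K'0 : 0 < K' by rewrite ltr_wpDl.
have gK' n i : normc (g n i) <= K'.
  by apply: le_trans (gK n i) _; have := ler_norm K; rewrite /K'; lra.
pose E := [set r : R | exists2 s : seq I, uniq s & r = \sum_(i <- s) normc (f i)].
have hE : has_sup E.
  split; first by exists 0; exists [::] => //; rewrite big_nil.
  by exists S => _ [s us ->]; exact: fS.
have d0 : 0 < e / (2 * K') by rewrite divr_gt0 // mulr_gt0.
(* Since [s] nearly attains the supremum, all that lies outside [s] contributes at most e/2 even
   with coefficients as large as [K']. On the finite [s] the coefficients are uniformly small from
   some rank on. *)
have [_ [s us ->] Hs] := sup_adherent d0 hE.
pose d := e / (2 * (`|S| + 1)).
have S0 : 0 < `|S| + 1 by rewrite ltr_wpDl.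
have dp : 0 < d by rewrite divr_gt0 // mulr_gt0.
have [N HN] : exists N, forall n i, (N <= n)%N -> i \in s -> normc (g n i) < d.
  elim: (s) => [|a t [N IH]]; first by exists 0%N.
  have /cvg_normcP/(_ _ dp) [M HM] := g0 a.
  exists (maxn N M) => n i; rewrite geq_max => /andP[Nn Mn].
  rewrite inE => /orP[/eqP ->|]; last exact: IH.
  by have := HM n Mn; rewrite subr0.
exists N => n Nn; rewrite subr0 /=.
apply: le_lt_trans (normc_sum _ _) _.
rewrite (bigID (mem s)) /=.
have H1 : \sum_(i <- A n | i \in s) normc (g n i * f i) <= d * S.
  apply: (@le_trans _ _ (\sum_(i <- A n | i \in s) d * normc (f i))).
    apply: ler_sum => i si; rewrite normcM ler_wpM2r ?normc_ge0 //.
    by rewrite ltW // HN.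
  rewrite -mulr_sumr; apply: ler_wpM2l; first exact: ltW.
  by rewrite -big_filter; apply: fS; rewrite filter_uniq.
have H2 : \sum_(i <- A n | i \notin s) normc (g n i * f i) <= e / 2.
  apply: (@le_trans _ _ (\sum_(i <- A n | i \notin s) K' * normc (f i))).
    by apply: ler_sum => i si; rewrite normcM ler_wpM2r ?normc_ge0.
  rewrite -mulr_sumr -ler_pdivlMl //.
  have -> : K'^-1 * (e / 2) = e / (2 * K') by field; rewrite gt_eqF.
  have : \sum_(i <- s) normc (f i) + \sum_(i <- A n | i \notin s) normc (f i)
      <= sup E.
    rewrite -[X in _ + X]big_filter -big_cat /=.
    apply: ub_le_sup; first by case: hE.
    eexists; last by [].
    rewrite cat_uniq us filter_uniq // andbT; apply/hasPn => i.
    by rewrite mem_filter => /andP[].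
  by move: Hs; lra.
have H3 : d * S < e / 2.
  apply: (@lt_le_trans _ _ (d * (`|S| + 1))).
    by rewrite ltr_pM2l //; have := ler_norm S; lra.
  by rewrite /d le_eqVlt; apply/orP; left; apply/eqP; field; rewrite gt_eqF.
by move: H1 H2 H3; lra.
Qed.

(** A finite set of pairs lies in the product of its two projections, over which the sum factors. *)
Lemma sum_normc_pair (I J : eqType) (a : I -> C) (b : J -> C) (Sa Sb : R) :
  (forall s, uniq s -> \sum_(i <- s) normc (a i) <= Sa) ->
  (forall s, uniq s -> \sum_(j <- s) normc (b j) <= Sb) ->
  forall s, uniq s -> \sum_(k <- s) normc (a k.1 * b k.2) <= Sa * Sb.
Proof.
move=> Ha Hb s us.
pose s1 := undup [seq k.1 | k <- s]; pose s2 := undup [seq k.2 | k <- s].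
apply: (@le_trans _ _ (\sum_(k <- [seq (i, j) | i <- s1, j <- s2])
    normc (a k.1 * b k.2))).
  apply: ler_sum_uniq_sub => // [||k]; last exact: normc_ge0.
    by rewrite allpairs_uniq ?undup_uniq // => -[i j] [i' j'] _ _ [-> ->].
  move=> [i j] sk; apply/allpairsP; exists (i, j); split => //=.
    by rewrite mem_undup; apply/mapP; exists (i, j).
  by rewrite mem_undup; apply/mapP; exists (i, j).
rewrite big_allpairs_dep /=.
under eq_bigr => i _ do under eq_bigr => j _ do rewrite normcM.
under eq_bigr => i _ do rewrite -mulr_sumr.
rewrite -mulr_suml ler_pM ?Ha ?Hb ?undup_uniq //.
  by apply: sumr_ge0 => i _; exact: normc_ge0.
by apply: sumr_ge0 => i _; exact: normc_ge0.
Qed.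

(** Written as (a^n Z)^n, the quantity is at most 1 once a^m Z <= 1 and n >= m; the finitely many
    earlier ones are at most (1 + Z)^m. *)
Lemma gaussian_decay (a Z : R) : 0 < a < 1 -> 0 <= Z ->
  exists2 K, 0 <= K & forall n : nat, a ^+ (n * n) * Z ^+ n <= K.
Proof.
move=> /andP[a0 a1] Z0.
have [m Hm] : exists m, a ^+ m * Z <= 1.
  have := @cvg_geometric R Z a; rewrite ger0_norm ?ltW // => /(_ a1).
  move/cvg_distP/(_ 1 ltr01) => [m Hm]; exists m.
  have := Hm m (leqnn m); rewrite subr0 => /ltW; apply: le_trans.
  by rewrite /geometric /= mulrC; exact: ler_norm.
exists ((1 + Z) ^+ m) => [|n]; first by rewrite exprn_ge0 // addr_ge0.
have h1 : 1 <= (1 + Z) ^+ m by rewrite exprn_ege1 // lerDl.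
have [mn|nm] := leqP m n.
  apply: le_trans h1; rewrite exprM -exprMn exprn_ile1 //.
    by rewrite mulr_ge0 // exprn_ge0 // ltW.
  by apply: le_trans Hm; rewrite ler_wpM2r // ler_wiXn2l ?(ltW a0) ?(ltW a1).
apply: (@le_trans _ _ (Z ^+ n)).
  by rewrite ler_piMl ?exprn_ge0 // exprn_ile1 // ltW.
apply: (@le_trans _ _ ((1 + Z) ^+ n)).
  by rewrite lerXn2r ?nnegrE ?addr_ge0 // lerDr.
by apply: ler_weXn2l; [rewrite lerDl|exact: ltnW].
Qed.

Lemma sum_int_geometric (h : int -> R) (K r : R) : 0 <= K -> 0 <= r < 1 ->
  (forall m, 0 <= h m) ->
  (forall n, h (Posz n) <= K * r ^+ n) -> (forall n, h (Negz n) <= K * r ^+ n) ->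
  forall s, uniq s -> \sum_(m <- s) h m <= 2 * (K * (1 - r)^-1).
Proof.
move=> K0 /andP[r0 r1] h0 hP hN s us.
have [N sN] : exists N, forall m, m \in s -> (absz m < N)%N.
  exists (\max_(m <- s) absz m).+1 => m sm; rewrite ltnS.
  exact: leq_bigmax_seq.
have iP : injective Posz by move=> ? ? [].
have iN : injective Negz by move=> ? ? [].
(* The geometric bound is borrowed from [sum_normq], with [r] read as a complex number. *)
have q1 : normc (r%:C%C) < 1 by rewrite /= expr0n /= addr0 sqrtr_sqr ger0_norm.
have geo : \sum_(n <- iota 0 N) K * r ^+ n <= K * (1 - r)^-1.
  rewrite -mulr_sumr ler_wpM2l //; have := sum_normq q1 N.
  by rewrite /index_iota subn0 /= expr0n /= addr0 sqrtr_sqr ger0_norm.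
apply: (@le_trans _ _ (\sum_(m <- map Posz (iota 0 N) ++ map Negz (iota 0 N)) h m)).
  apply: ler_sum_uniq_sub => //.
    rewrite cat_uniq !map_inj_uniq ?iota_uniq // andbT.
    by apply/hasPn => _ /mapP[n _ ->]; apply/mapP => -[].
  move=> m sm; have mN := sN m sm.
  rewrite mem_cat; case: m sm mN => n sm mN.
    by apply/orP; left; apply/mapP; exists n; rewrite // mem_iota.
  apply/orP; right; apply/mapP; exists n; rewrite // mem_iota /=.
  exact: ltn_trans mN.
rewrite big_cat !big_map /= mulr2n mulrDl mul1r.
by apply: lerD; apply: le_trans geo; apply: ler_sum => n _; [exact: hP|exact: hN].
Qed.

End DominatedConvergence.

(** * The three-term relation *)

Section ThetaQuasiperiod.
Context {R : realType}.
Local Notation C := R[i].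
Variable q : C.
Hypothesis q1 : normc q < 1.
Hypothesis q0 : q != 0.

Lemma qtheta_mulq (x : C) : x != 0 -> qtheta q (q * x) = - x^-1 * qtheta q x.
Proof.
move=> x0; rewrite /qtheta /qpoch2.
have -> : q / (q * x) = x^-1 by field; rewrite x0 q0.
rewrite (qpoch_rec q1 x) (qpoch_rec q1 x^-1) (mulrC x q) (mulrC x^-1 q).
by field.
Qed.

(** theta(1/x) and theta(qx) are made of the same two products, so inversion reduces to
    quasi-periodicity. *)
Lemma qtheta_inv (x : C) : x != 0 -> qtheta q x^-1 = - x^-1 * qtheta q x.
Proof.
move=> x0; rewrite -(qtheta_mulq x0) /qtheta /qpoch2 invrK [LHS]mulrC.
by congr (_ * qpoch q _); field; rewrite ?x0 ?q0.
Qed.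

End ThetaQuasiperiod.

(** * The triple product in the limit, and the addition formula for theta *)

Section Weierstrass.
Context {R : realType}.
Local Notation C := R[i].
Local Notation cvgc u l := ((u : nat -> C^o) @ \oo --> (l : C^o)).

Lemma cvgc_subseq (u : nat -> C) (l : C) (h : nat -> nat) :
  (forall n, (n <= h n)%N) -> cvgc u l -> cvgc (fun n => u (h n)) l.
Proof.
move=> hn /cvg_normcP ul; apply/cvg_normcP => e /ul[N HN].
by exists N => n Nn; apply: HN; exact: leq_trans (hn n).
Qed.

Lemma cvgc_bounded (u : nat -> C) (l : C) : cvgc u l ->
  exists K, forall n, normc (u n) <= K.
Proof.
move=> /cvg_normcP/(_ 1 ltr01)[N HN].
exists (normc l + 1 + \sum_(0 <= k < N) normc (u k)) => n.
have S0 : 0 <= \sum_(0 <= k < N) normc (u k).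
  by apply: sumr_ge0 => k _; exact: normc_ge0.
have [Nn|nN] := leqP N n.
  have := HN n Nn; have := le_normcD (u n - l) l; rewrite subrK; lra.
rewrite (bigD1_seq n) ?mem_index_iota ?iota_uniq //=.
have := normc_ge0 l.
have : 0 <= \sum_(0 <= k < N | k != n) normc (u k).
  by apply: sumr_ge0 => k _; exact: normc_ge0.
lra.
Qed.

Lemma cvgcB (u v : nat -> C) (l m : C) :
  cvgc u l -> cvgc v m -> cvgc (fun n => u n - v n) (l - m).
Proof. by move=> ul vm; exact: (@cvgB C C^o _ _ _ u v l m ul vm). Qed.

Lemma cvgcV (u : nat -> C) (l : C) :
  l != 0 -> cvgc u l -> cvgc (fun n => (u n)^-1) l^-1.
Proof. by move=> l0 ul; exact: (@cvgV C _ _ _ u l l0 ul). Qed.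

Lemma sum_uniq_support (I : eqType) (s t : seq I) (f : I -> C) :
  uniq s -> uniq t -> {subset s <= t} -> (forall i, i \notin s -> f i = 0) ->
  \sum_(i <- t) f i = \sum_(i <- s) f i.
Proof.
move=> us ut st f0; rewrite (bigID (mem s)) /= [X in _ + X]big1 // addr0.
rewrite -big_filter; apply: perm_big; apply: uniq_perm; rewrite ?filter_uniq //.
move=> i; rewrite mem_filter; by case: (boolP (i \in s)) => // /st ->.
Qed.

Variables q p : C.
Hypothesis q1 : normc q < 1.
Hypothesis q0 : q != 0.
Hypothesis pq : p ^+ 2 = q.

Let p0 : p != 0.
Proof. by apply: contra_neq q0 => p0; rewrite -pq p0 expr0n. Qed.

Let np : 0 < normc p < 1.
Proof.
have p1 : normc p ^+ 2 < 1 by rewrite -normcX pq.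
rewrite lt_neqAle normc_ge0 andbT eq_sym; apply/andP; split.
  by apply: contra_neq p0; exact: eq0_normc.
by rewrite -(@expr_lt1 _ 2) ?normc_ge0.
Qed.

Lemma jterm_summable (x : C) : x != 0 ->
  exists S, forall s, uniq s -> \sum_(m <- s) normc (jterm p x m) <= S.
Proof.
move=> x0; have /andP[a0 a1] := np; set a := normc p in a0 a1 *.
set Z := normc x; have Z0 : 0 < Z.
  rewrite lt_neqAle normc_ge0 andbT eq_sym.
  by apply: contra_neq x0; exact: eq0_normc.
have an0 : a != 0 by rewrite gt_eqF.
have Zn0 : Z != 0 by rewrite gt_eqF.
(* The exponent m^2 - m is n^2 - n at m = n and n^2 + 3n + 2 at m = -(n+1). After a^(n^2) and one
   geometric factor a^n are set aside, the powers of these two ratios remain. *)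
have Z1 : 0 <= Z / a ^+ 2 by rewrite divr_ge0 ?exprn_ge0 // ltW.
have Z2 : 0 <= a ^+ 2 / Z by rewrite divr_ge0 ?exprn_ge0 // ltW.
have [K1 K10 H1] := gaussian_decay np Z1.
have [K2 K20 H2] := gaussian_decay np Z2.
have nN1 (m : int) : normc ((-1 : C) ^ m) = 1.
  case: m => n; rewrite ?NegzE -?invr_expz ?normcV.
    by rewrite -[_ ^ _]/(_ ^+ n) normcX normcN normc1 expr1n.
  by rewrite -[_ ^ _]/(_ ^+ n.+1) normcX normcN normc1 expr1n invr1.
exists (2 * ((K1 + K2 * (a ^+ 2 / Z)) * (1 - a)^-1)).
apply: sum_int_geometric => [|||n|n].
- by rewrite addr_ge0 // mulr_ge0.
- by rewrite ltW.
- by move=> m; exact: normc_ge0.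
- rewrite /jterm !normcM nN1 mul1r expfzDr // -invr_expz normcM normcV -PoszM.
  rewrite -[p ^ Posz (n * n)]/(p ^+ (n * n)) -[p ^ n]/(p ^+ n) -[x ^ n]/(x ^+ n).
  rewrite !normcX -/a -/Z.
  rewrite [leLHS](_ : _ = (a ^+ (n * n) * (Z / a ^+ 2) ^+ n) * a ^+ n).
    rewrite ler_wpM2r ?exprn_ge0 ?(ltW a0) //.
    by apply: le_trans (H1 n) _; rewrite lerDl mulr_ge0.
  by rewrite expr_div_n -exprM (mulnC 2%N n) (exprM a n 2%N); field; rewrite expf_neq0.
- rewrite /jterm !normcM nN1 mul1r.
  have -> : Negz n * Negz n - Negz n = (n * n + 3 * n + 2)%N%:Z.
    by rewrite NegzE -addn1 !PoszD !PoszM; ring.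
  rewrite -[p ^ _]/(p ^+ (n * n + 3 * n + 2)) -[x ^ _]/((x ^+ n.+1)^-1).
  rewrite normcV !normcX -/a -/Z.
  rewrite [leLHS](_ : _ =
    (a ^+ (n * n) * (a ^+ 2 / Z) ^+ n) * (a ^+ 2 / Z) * a ^+ n).
    rewrite ler_wpM2r ?exprn_ge0 ?(ltW a0) //.
    apply: (@le_trans _ _ (K2 * (a ^+ 2 / Z))); first by rewrite ler_wpM2r.
    by rewrite lerDr.
  rewrite (exprD a (n * n + 3 * n)%N 2%N) (exprD a (n * n)%N (3 * n)%N) expr_div_n.
  rewrite -(exprM a 2%N n) (mulnC 2%N n) (mulnC 3%N n) (exprS Z n).
  rewrite (exprM a n 2%N) (exprM a n 3%N).
  by field; rewrite Zn0 expf_neq0.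
Qed.

Let P := qprod q q.
Let L := qpoch q q.

Lemma mulqX_neq1 k : q * q ^+ k != 1.
Proof.
rewrite -exprS; apply/eqP => /(congr1 (@normc R)).
rewrite normcX normc1 => E.
by have := exprn_ilt1 k.+1 (normc_ge0 q) q1; rewrite E ltxx.
Qed.

Let L0 : L != 0.
Proof. by apply: qpoch_neq0 => // k; exact: mulqX_neq1. Qed.

Let P0 n : P n != 0.
Proof.
rewrite /P /qprod prodf_seq_neq0; apply/allP => k _ /=.
by rewrite subr_eq0 eq_sym mulqX_neq1.
Qed.

Let PL : cvgc P L.
Proof. exact: qprod_cvg. Qed.

(** The guard matters for m < -N, where [absz] would reflect N + m back into the range of nonzero
    coefficients. *)
Definition jcoef (N : nat) (m : int) : C :=
  if (absz m <= N)%N then qbinom q (N + N) (absz (N%:Z + m)%R) else 0.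

Lemma jcoefE N m : (absz m <= N)%N ->
  jcoef N m = P (N + N) / (P (absz (N%:Z + m)%R) * P (absz (N%:Z - m)%R)).
Proof.
move=> mN; rewrite /jcoef mN.
have E : (absz (N%:Z + m)%R + absz (N%:Z - m)%R = N + N)%N by lia.
by rewrite /P -(qbinom_qprod q E) mulfK // mulf_neq0 // P0.
Qed.

(** Uniformity in both [N] and [m] supplies the domination for [tannery]. It holds because (q)_n and
    its inverse converge and are therefore bounded. *)
Lemma jcoef_bounded : exists K, forall N m, normc (jcoef N m) <= K.
Proof.
have [K1 H1] := cvgc_bounded PL.
have [K2 H2] := cvgc_bounded (cvgcV L0 PL).
have K10 : 0 <= K1 := le_trans (normc_ge0 _) (H1 0%N).
have K20 : 0 <= K2 := le_trans (normc_ge0 _) (H2 0%N).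
exists (K1 * (K2 * K2)) => N m; have [mN|mN] := leqP (absz m) N.
  rewrite jcoefE // invfM !normcM.
  by rewrite ler_pM ?mulr_ge0 ?normc_ge0 ?H1 // ler_pM ?normc_ge0 ?H2.
have -> : jcoef N m = 0 by rewrite /jcoef leqNgt mN.
by rewrite normc0 !mulr_ge0.
Qed.

Lemma jcoef_cvg m : cvgc (fun N => jcoef N m) L^-1.
Proof.
apply/(cvgc_shift (absz m)).
have -> : (fun n => jcoef (n + absz m) m) = fun n =>
    P ((n + absz m) + (n + absz m)) *
    (P (absz ((n + absz m)%N%:Z + m)) * P (absz ((n + absz m)%N%:Z - m)))^-1.
  by apply/funext => n; rewrite jcoefE // leq_addl.
rewrite (_ : L^-1 = L * (L * L)^-1); last by field; rewrite L0.
have c (h : nat -> nat) (hn : forall n, (n <= h n)%N) :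
  cvgc (fun n => P (h n)) L := cvgc_subseq hn PL.
have c1 : cvgc (fun n => P (n + absz m + (n + absz m))) L by apply: c => n; lia.
have c2 : cvgc (fun n => P (absz ((n + absz m)%N%:Z + m))) L by apply: c => n; lia.
have c3 : cvgc (fun n => P (absz ((n + absz m)%N%:Z - m))) L by apply: c => n; lia.
exact: (cvgcM c1 (cvgcV (mulf_neq0 L0 L0) (cvgcM c2 c3))).
Qed.

(** The cut-off of the sums e and o, whereas [cwindow], closed at both ends, is the index range of
    the finite triple product. *)
Definition window (N : nat) : seq int := [seq k%:Z - N%:Z | k <- iota 0 (N + N)].
Definition cwindow (N : nat) : seq int :=
  [seq k%:Z - N%:Z | k <- iota 0 (N + N).+1].

Lemma mem_window N m : (m \in window N) = (- N%:Z <= m < N%:Z).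
Proof.
apply/mapP/idP => [[k]|Hm]; first by rewrite mem_iota => ? ->; lia.
by exists (absz (m + N%:Z)); rewrite ?mem_iota; lia.
Qed.

Lemma mem_cwindow N m : (m \in cwindow N) = (absz m <= N)%N.
Proof.
apply/mapP/idP => [[k]|Hm]; first by rewrite mem_iota => ? ->; lia.
by exists (absz (m + N%:Z)); rewrite ?mem_iota; lia.
Qed.

Lemma uniq_window N : uniq (window N).
Proof. by rewrite map_inj_uniq ?iota_uniq // => i j; lia. Qed.

Lemma uniq_cwindow N : uniq (cwindow N).
Proof. by rewrite map_inj_uniq ?iota_uniq // => i j; lia. Qed.

Lemma jacobi_cwindow (x : C) N : x != 0 ->
  qprod q x N * qprod q (q / x) N
  = \sum_(m <- cwindow N) jcoef N m * jterm p x m.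
Proof.
move=> x0; rewrite (finite_jacobi_triple q0 pq) // big_map.
rewrite -(big_mkord xpredT
  (fun i => qbinom q (N + N) i * jterm p x (i%:Z - N%:Z))) /index_iota subn0.
apply: eq_big_seq => k; rewrite mem_iota /= add0n ltnS => kN.
have h : (absz (k%:Z - N%:Z)%R <= N)%N by lia.
by rewrite /jcoef h (_ : absz (N%:Z + (k%:Z - N%:Z)) = k) //; lia.
Qed.

(* The pairs (m, n) with m - n = 2 j and with m - n = 2 j + 1. *)
Definition diamond (N : nat) : seq (int * int) :=
  [seq (i + j + 1, i - j + 1) | i <- window N, j <- window N] ++
  [seq (i + j + 1, i - j) | i <- window N, j <- window N].

Lemma uniq_diamond N : uniq (diamond N).
Proof.
rewrite cat_uniq; apply/and3P; split.
- apply: allpairs_uniq; rewrite ?uniq_window // => -[i j] [i' j'] _ _ /= [].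
  by move=> ? ?; congr (_, _); lia.
- apply/hasPn => _ /allpairsP[[i j] [_ _ ->]] /=.
  by apply/negP => /allpairsP[[i' j'] [_ _ [] /=]]; lia.
- apply: allpairs_uniq; rewrite ?uniq_window // => -[i j] [i' j'] _ _ /= [].
  by move=> ? ?; congr (_, _); lia.
Qed.

(** The parity of m - n picks the half, and [j] is the quotient of m - n by 2. Exhaustion of all
    pairs is what gives the pointwise limits in [wronsk_cvg]. *)
Lemma mem_diamond k : exists N, forall n, (N <= n)%N -> k \in diamond n.
Proof.
case: k => m n; exists (absz m + absz n + 2)%N => N HN.
rewrite mem_cat; apply/orP.
have [[j Hj]|[j Hj]] : (exists j : int, m - n = 2 * j) \/
    (exists j : int, m - n = 2 * j + 1).
  have := divz_eq (m - n) 2; set d := (_ %/ _)%Z; set e := (_ %% _)%Z => E.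
  have : e = 0 \/ e = 1 by lia.
  by case=> e01; [left|right]; exists d; lia.
- left; apply/allpairsP; exists (n - 1 + j, j).
  by rewrite !mem_window; split => /=; [lia|lia|congr (_, _); lia].
- right; apply/allpairsP; exists (n + j, j).
  by rewrite !mem_window; split => /=; [lia|lia|congr (_, _); lia].
Qed.

Definition esum_window (x : C) N : C := \sum_(i <- window N) eterm p x i.
Definition osum_window (x : C) N : C := \sum_(i <- window N) oterm p x i.
(** The 2x2 minor whose rows are the vectors (o, e) at [x] and at [y]. *)
Definition wronsk (N : nat) (x y : C) : C :=
  osum_window x N * esum_window y N - esum_window x N * osum_window y N.

Lemma sum_diamond (x y : C) N : x != 0 -> y != 0 ->
  \sum_(k <- diamond N) jterm p (x * y) k.1 * jterm p (x / y) k.2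
  = x * wronsk N x y.
Proof.
move=> x0 y0; rewrite big_cat /= !big_allpairs_dep /=.
under eq_bigr => i _ do under eq_bigr => j _ do rewrite (jterm_even q0 pq) //.
under [X in _ + X]eq_bigr => i _ do
  under eq_bigr => j _ do rewrite (jterm_odd q0 pq) //.
rewrite /wronsk mulrBr /esum_window /osum_window !big_distrlr /= !mulr_sumr.
congr (_ + _); first by apply: eq_bigr => i _; rewrite mulr_sumr.
rewrite -sumrN; apply: eq_bigr => i _; rewrite mulr_sumr -sumrN.
by apply: eq_bigr => j _.
Qed.

(** The sum over the square, with the coefficients of two finite triple products, minus the sum over
    the diamond, with constant coefficient 1/(q)_oo^2, is a single sum over the union [A N]. Its
    coefficients [g] are bounded and tend to 0 at every pair, so [tannery] makes it vanish in the
    limit, while the square tends to the theta product. *)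
Lemma wronsk_cvg (x y : C) : x != 0 -> y != 0 ->
  cvgc (fun N => x * wronsk N x y)
       (L ^+ 2 * (qtheta q (x * y) * qtheta q (x / y))).
Proof.
move=> x0 y0.
have xy0 : x * y != 0 by rewrite mulf_neq0.
have xdy0 : x / y != 0 by rewrite mulf_neq0 ?invr_eq0.
pose f (k : int * int) := jterm p (x * y) k.1 * jterm p (x / y) k.2.
pose g N (k : int * int) := jcoef N k.1 * jcoef N k.2
  - (L^-1) ^+ 2 * (k \in diamond N)%:R.
pose sq N := [seq (m, n) | m <- cwindow N, n <- cwindow N].
pose A N := undup (sq N ++ diamond N).
have usq N : uniq (sq N).
  by rewrite allpairs_uniq ?uniq_cwindow // => -[i j] [i' j'] _ _ [-> ->].
have [S1 HS1] := jterm_summable xy0; have [S2 HS2] := jterm_summable xdy0.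
have [K HK] := jcoef_bounded.
have K0 : 0 <= K := le_trans (normc_ge0 _) (HK 0%N 0).
have lim0 : cvgc (fun N => \sum_(k <- A N) g N k * f k) 0.
  apply: (@tannery _ _ f (S1 * S2) (K * K + normc (L^-1 ^+ 2))) => [|N k|k|N].
  - exact: (sum_normc_pair HS1 HS2).
  - apply: le_trans (le_normcD _ _) _; rewrite normcN; apply: lerD.
      by rewrite normcM ler_pM ?normc_ge0 ?HK.
    by case: (_ \in _); rewrite ?mulr1 // mulr0 normc0 normc_ge0.
  - have [N0 HN0] := mem_diamond k; apply/(cvgc_shift N0).
    have -> : (fun n => g (n + N0)%N k) = (fun n =>
        jcoef (n + N0) k.1 * jcoef (n + N0) k.2 - L^-1 * L^-1).
      by apply/funext => n; rewrite /g HN0 ?leq_addl // mulr1 expr2.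
    rewrite -(subrr (L^-1 * L^-1)); apply: cvgcB; last exact: cvg_cst.
    apply: cvgcM; first exact/(cvgc_shift N0 (fun N => jcoef N k.1))/jcoef_cvg.
    exact/(cvgc_shift N0 (fun N => jcoef N k.2))/jcoef_cvg.
  - exact: undup_uniq.
have theta_cvg z : cvgc (fun N => qprod q z N * qprod q (q / z) N) (qtheta q z).
  by apply: cvgcM; exact: qprod_cvg.
have E N : \sum_(k <- A N) g N k * f k
   = (qprod q (x * y) N * qprod q (q / (x * y)) N) *
     (qprod q (x / y) N * qprod q (q / (x / y)) N)
     - (L^-1) ^+ 2 * (x * wronsk N x y).
  rewrite /g; under eq_bigr => k _ do rewrite mulrBl.
  rewrite sumrB; congr (_ - _).
    rewrite (sum_uniq_support (s := sq N)) ?undup_uniq //.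
    - rewrite big_allpairs_dep /= !jacobi_cwindow // big_distrlr /=.
      by apply: eq_bigr => m _; apply: eq_bigr => n _; rewrite /f /=; ring.
    - by move=> k ks; rewrite mem_undup mem_cat ks.
    - case=> m n; apply: contraNeq => H; apply/allpairsP; exists (m, n).
      have HH (l : int) : jcoef N l != 0 -> l \in cwindow N.
        by rewrite mem_cwindow /jcoef; case: leqP => //; rewrite eqxx.
      by move: H; rewrite /= !mulf_eq0 !negb_or => /andP[/andP[/HH ? /HH ?] _].
  rewrite -(sum_diamond N x0 y0) mulr_sumr.
  rewrite (sum_uniq_support (s := diamond N)) ?undup_uniq ?uniq_diamond //.
  - by apply: eq_big_seq => k ->; rewrite mulr1.
  - by move=> k ks; rewrite mem_undup mem_cat ks orbT.
  - by move=> k /negPf ->; rewrite mulr0 mul0r.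
have -> : (fun N => x * wronsk N x y) = fun N => L ^+ 2 *
    ((qprod q (x * y) N * qprod q (q / (x * y)) N) *
     (qprod q (x / y) N * qprod q (q / (x / y)) N)
     - \sum_(k <- A N) g N k * f k).
  by apply/funext => N; rewrite E; field; rewrite L0.
have := cvgcB (cvgcM (theta_cvg (x * y)) (theta_cvg (x / y))) lim0.
by rewrite subr0; exact: cvgcZ.
Qed.

(** For every cut-off the Pluecker relation among the vectors (o, e) at [a], [b], [c], [d] is exact,
    so both sides are limits of the same sequence. *)
Lemma qtheta_addition (a b c d : C) : a != 0 -> b != 0 -> c != 0 -> d != 0 ->
  qtheta q (a * b) * qtheta q (a / b) * (qtheta q (c * d) * qtheta q (c / d))
  - qtheta q (a * d) * qtheta q (a / d) * (qtheta q (c * b) * qtheta q (c / b))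
  = c / b *
    (qtheta q (a * c) * qtheta q (a / c) * (qtheta q (b * d) * qtheta q (b / d))).
Proof.
move=> a0 b0 c0 d0.
have L40 : L ^+ 2 * L ^+ 2 != 0 by rewrite !mulf_neq0 ?expf_neq0.
apply: (mulfI L40).
have H := cvgcB (cvgcM (wronsk_cvg a0 b0) (wronsk_cvg c0 d0))
  (cvgcM (wronsk_cvg a0 d0) (wronsk_cvg c0 b0)).
have H' := cvgcZ (a := c / b) (cvgcM (wronsk_cvg a0 c0) (wronsk_cvg b0 d0)).
have E : (fun n => a * wronsk n a b * (c * wronsk n c d)
    - a * wronsk n a d * (c * wronsk n c b))
  = (fun n => c / b * (a * wronsk n a c * (b * wronsk n b d))).
  have plucker (oa ea ob eb oc ec od ed : C) :
      a * (oa * eb - ea * ob) * (c * (oc * ed - ec * od))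
      - a * (oa * ed - ea * od) * (c * (oc * eb - ec * ob))
      = c / b * (a * (oa * ec - ea * oc) * (b * (ob * ed - eb * od))) by field.
  by apply/funext => n; exact: plucker.
rewrite E in H; have {H' E}Heq := cvgc_unique H H'.
have E (X1 X2 X3 X4 : C) :
    L ^+ 2 * L ^+ 2 * (X1 * X2 - X3 * X4)
    = L ^+ 2 * X1 * (L ^+ 2 * X2) - L ^+ 2 * X3 * (L ^+ 2 * X4) by ring.
by rewrite E Heq; ring.
Qed.

End Weierstrass.

Lemma weierstrass_three_term {R : realType} (q : R[i]) : normc q < 1 -> q != 0 ->
  forall m p1 p2 p3 p4 : R[i], p1 != 0 -> p2 != 0 -> p3 != 0 -> p4 != 0 ->
  m ^+ 2 = p1 * p2 * p3 * p4 ->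
  qtheta q p1 * qtheta q p2 * qtheta q p3 * qtheta q p4
  - qtheta q (m / p1) * qtheta q (m / p2) * qtheta q (m / p3) * qtheta q (m / p4)
  = m / p1 * (qtheta q m * qtheta q (m / (p3 * p4)) *
              qtheta q (m / (p2 * p4)) * qtheta q (m / (p2 * p3))).
Proof.
move=> q1 q0 m p1 p2 p3 p4 n1 n2 n3 n4 Hm.
(* The parameters of [qtheta_addition] are [a], [p1 / a], [m / a] and [p3 * a / m]: the first two
   have product p1 and quotient p2, the last two have product p3 and quotient p4. Eliminating [p2]
   and [p4] leaves independent letters for [field]. *)
pose a := sqrtc (p1 * p2).
have a2 : a ^+ 2 = p1 * p2 by exact: sqr_sqrtc.
have a0 : a != 0.
  by apply: contra_neq (mulf_neq0 n1 n2) => a0; rewrite -a2 a0 expr0n.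
have m0 : m != 0.
  apply: contra_neq (mulf_neq0 (mulf_neq0 (mulf_neq0 n1 n2) n3) n4) => m0.
  by rewrite -Hm m0 expr0n.
have b0 : p1 / a != 0 by rewrite mulf_neq0 ?invr_eq0.
have c0 : m / a != 0 by rewrite mulf_neq0 ?invr_eq0.
have d0 : p3 * a / m != 0 by rewrite !mulf_neq0 ?invr_eq0.
have E2 : p2 = a ^+ 2 / p1 by rewrite a2; field.
have E4 : p4 = m ^+ 2 / (a ^+ 2 * p3).
  by rewrite Hm a2; field; rewrite n1 n2 n3.
have := qtheta_addition q1 q0 (sqr_sqrtc q) a0 b0 c0 d0.
rewrite {}E2 {}E4.
have -> : a * (p1 / a) = p1 by field.
have -> : a / (p1 / a) = a ^+ 2 / p1 by field; rewrite ?a0 ?n1.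
have -> : m / a * (p3 * a / m) = p3 by field; rewrite ?a0 ?m0.
have -> : m / a / (p3 * a / m) = m ^+ 2 / (a ^+ 2 * p3).
  by field; rewrite ?a0 ?m0 ?n3.
have -> : m / (m ^+ 2 / (a ^+ 2 * p3)) = a * (p3 * a / m).
  by field; rewrite ?a0 ?m0 ?n3.
have -> : m / p3 = a / (p3 * a / m) by field; rewrite ?a0 ?m0 ?n3.
have -> : m / (a ^+ 2 / p1) = m / a * (p1 / a) by field; rewrite ?a0 ?m0 ?n1.
have -> : m / p1 = m / a / (p1 / a) by field; rewrite ?a0 ?m0 ?n1.
have -> : a * (m / a) = m by field.
have -> : m / (p3 * (m ^+ 2 / (a ^+ 2 * p3))) = a / (m / a).
  by field; rewrite ?a0 ?m0 ?n3.
have -> : m / (a ^+ 2 / p1 * (m ^+ 2 / (a ^+ 2 * p3))) = p1 / a * (p3 * a / m).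
  by field; rewrite ?a0 ?m0 ?n3 ?n1.
have -> : m / (a ^+ 2 / p1 * p3) = p1 / a / (p3 * a / m).
  by field; rewrite ?a0 ?m0 ?n3 ?n1.
have E (t1 t2 t3 t4 t5 t6 t7 t8 t9 t10 t11 t12 k : R[i]) :
  t1 * t2 * (t3 * t4) - t5 * t6 * (t7 * t8) = k * (t9 * t10 * (t11 * t12)) ->
  t1 * t2 * t3 * t4 - t8 * t7 * t6 * t5 = k * (t9 * t10 * t11 * t12).
  by move=> H; rewrite !mulrA in H *; rewrite -H; ring.
exact: E.
Qed.

(** * Scalar Yang-Baxter identities *)

Section CoreYangBaxter.
Variables (K : fieldType) (q : K) (poch th : K -> K).
Hypothesis thE : forall x, th x = poch x * poch (q / x).
Hypothesis thV : forall x, x != 0 -> th x^-1 = - x^-1 * th x.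
Hypothesis thW : forall m p1 p2 p3 p4 : K,
  p1 != 0 -> p2 != 0 -> p3 != 0 -> p4 != 0 -> m ^+ 2 = p1 * p2 * p3 * p4 ->
  th p1 * th p2 * th p3 * th p4
  - th (m / p1) * th (m / p2) * th (m / p3) * th (m / p4)
  = m / p1 * (th m * th (m / (p3 * p4)) * th (m / (p2 * p4)) * th (m / (p2 * p3))).

(* The entries of the 2x2 block after the gauge transformation and without the power
   of [w]; [a], [b] are b_r, b_(r+1) and [D] is c_k / (b_(r+2) ... b_M). *)
Definition core00 (w a b D : K) : K :=
  poch (q / b) * poch a * th (w * D / b) / (th (D / b) * th (w * a)).
Definition core01 (w a b : K) : K := th w / th (w * a).
Definition core10 (w a b D : K) : K :=
  b * th (D / (a * b)) * th D / (th (D / a) * th (D / b))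
  * (th (w * a / b) / th (w * a)).
Definition core11 (w a b D : K) : K :=
  poch (q / a) * poch b * th (D / (a * w)) / (th (D / a) * th (w * a)).

(* [no] and [ni] are the gauge factors of the row and of the column; [A], [B], [G]
   stand for the powers of [w] with exponents beta_r, beta_(r+1) and
   gamma_k - beta_(r+2) - ... - beta_M. *)
Definition gauged00 (w a b D no ni A B G : K) : K := no / ni * (core00 w a b D * (G /
  (A * B))).
Definition gauged01 (w a b no ni A : K) : K := no / ni * (core01 w a b * A^-1).
Definition gauged10 (w a b D no ni B : K) : K := no / ni * (core10 w a b D * B^-1).
Definition gauged11 (w a b D no ni G : K) : K := no / ni * (core11 w a b D * (w / G)).

Variables x y z D u v : K.
Hypotheses (x0 : x != 0) (y0 : y != 0) (z0 : z != 0) (D0 : D != 0).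
Hypotheses (u0 : u != 0) (v0 : v != 0).
Hypotheses (tx : th (D / x) != 0) (ty : th (D / y) != 0) (tz : th (D / z) != 0).
Hypotheses (txy : th (D / (x * y)) != 0) (txz : th (D / (x * z)) != 0).
Hypotheses (tyz : th (D / (y * z)) != 0).
Hypotheses (tuy : th (u * y) != 0) (tvx : th (v * x) != 0).
Hypotheses (tuvx : th (u * v * x) != 0).

Ltac nz := rewrite ?(mulf_eq0, invr_eq0, expf_eq0, oner_eq0, negb_or, x0, y0, z0, D0,
  u0, v0, tx, ty, tz, txy, txz, tyz, tuy, tvx, tuvx) //=.
Ltac fld := by field; nz.

Lemma thVM (a b : K) : a != 0 -> b != 0 -> th (a / b) = - (a / b) * th (b / a).
Proof.
move=> a0 b0; rewrite -[a / b]invrK thV ?invr_eq0 ?mulf_neq0 ?invr_eq0 //.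
by rewrite invrK invf_div.
Qed.

Lemma th1V (a : K) : a != 0 -> th (1 / a) = - (1 / a) * th a.
Proof. by move=> a0; rewrite thVM ?oner_eq0 // divr1. Qed.

(** Each [theta_rel] bears the indices of the entry of the 3x3 block that it serves. The arguments
    of one product are p1, ..., p4, and [m] is a monomial whose square is their product; arguments
    that come out inverted are turned round by [thV]. *)
Lemma theta_rel00 :
  th (u * v * x) * th y * th (u * D / (x * z)) * th (v * D / (y * z))
  + y * th u * th (u * v * D / z) * th (D / (x * y * z)) * th (v * x / y)
  = th (u * v * D / (y * z)) * th (D / (x * z)) * th (u * y) * th (v * x).
Proof.
have [n1 n2 n3 n4] : [/\ u * v * x != 0, y != 0, u * D / (x * z) != 0 & v * D / (y * z)
  != 0].
  by split; nz.
have sq : (u * v * D / z) ^+ 2 = (u * v * x) * y * (u * D / (x * z)) * (v * D / (y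
  * z)) by fld.
have H := thW n1 n2 n3 n4 sq.
rewrite (_ : u * v * D / z / (u * v * x) = D / (x * z)) in H; last by fld.
rewrite (_ : u * v * D / z / y = u * v * D / (y * z)) in H; last by fld.
rewrite (_ : u * v * D / z / (u * D / (x * z)) = v * x) in H; last by fld.
rewrite (_ : u * v * D / z / (v * D / (y * z)) = u * y) in H; last by fld.
rewrite (_ : u * v * D / z / (u * D / (x * z) * (v * D / (y * z))) = x * y * z / D)
  in H; last by fld.
rewrite (_ : u * v * D / z / (y * (v * D / (y * z))) = u) in H; last by fld.
rewrite (_ : u * v * D / z / (y * (u * D / (x * z))) = v * x / y) in H; last by fld.
rewrite (@thVM (x * y * z) D) in H; do ?by nz.
move/eqP: H; rewrite -subr_eq0 => /eqP H.
(* Zero is replaced by a multiple of the vanishing expression in [H], which leaves a rational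
   identity. The later proofs repeat this with other multipliers. *)
apply/eqP; rewrite -subr_eq0; apply/eqP; rewrite -[RHS](mulr0 1) -H; fld.
Qed.

Lemma theta_rel01 :
  th (u * D / (x * z)) * th v * th (D / z) * th (u * v * x)
  + v * th u * th x * th (u * v * D / z) * th (D / (x * z * v))
  = th (u * v) * th (u * D / z) * th (D / (x * z)) * th (v * x).
Proof.
have [n1 n2 n3 n4] : [/\ u * D / (x * z) != 0, v != 0, D / z != 0 & u * v * x != 0].
  by split; nz.
have sq : (u * v * D / z) ^+ 2 = (u * D / (x * z)) * v * (D / z) * (u * v * x) by
  fld.
have H := thW n1 n2 n3 n4 sq.
rewrite (_ : u * v * D / z / (u * D / (x * z)) = v * x) in H; last by fld.
rewrite (_ : u * v * D / z / v = u * D / z) in H; last by fld.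
rewrite (_ : u * v * D / z / (D / z) = u * v) in H; last by fld.
rewrite (_ : u * v * D / z / (u * v * x) = D / (x * z)) in H; last by fld.
rewrite (_ : u * v * D / z / (D / z * (u * v * x)) = 1 / x) in H; last by fld.
rewrite (_ : u * v * D / z / (v * (u * v * x)) = D / (x * z * v)) in H; last by fld.
rewrite (_ : u * v * D / z / (v * (D / z)) = u) in H; last by fld.
rewrite (@th1V x) in H; do ?by nz.
move/eqP: H; rewrite -subr_eq0 => /eqP H.
apply/eqP; rewrite -subr_eq0; apply/eqP; rewrite -[RHS](mulr0 1) -H; fld.
Qed.

Lemma theta_rel10 :
  z * th (D / x) * th (u * y / z) * th (v * D / (y * z)) * th (u * v * x)
  + u * y * th z * th (D / (x * y * u)) * th (u * v * D / z) * th (v * x / y)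
  = z * th (v * D / y) * th (u * v * x / z) * th (D / (x * z)) * th (u * y).
Proof.
have [n1 n2 n3 n4] : [/\ D / x != 0, u * y / z != 0, v * D / (y * z) != 0 & u * v * x
  != 0].
  by split; nz.
have sq : (u * v * D / z) ^+ 2 = (D / x) * (u * y / z) * (v * D / (y * z)) * (u * v *
  x) by fld.
have H := thW n1 n2 n3 n4 sq.
rewrite (_ : u * v * D / z / (D / x) = u * v * x / z) in H; last by fld.
rewrite (_ : u * v * D / z / (u * y / z) = v * D / y) in H; last by fld.
rewrite (_ : u * v * D / z / (v * D / (y * z)) = u * y) in H; last by fld.
rewrite (_ : u * v * D / z / (u * v * x) = D / (x * z)) in H; last by fld.
rewrite (_ : u * v * D / z / (v * D / (y * z) * (u * v * x)) = y / (v * x)) in H;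
  last by fld.
rewrite (_ : u * v * D / z / (u * y / z * (u * v * x)) = D / (x * y * u)) in H; last
  by fld.
rewrite (_ : u * v * D / z / (u * y / z * (v * D / (y * z))) = z) in H; last by fld.
rewrite (@thVM y (v * x)) in H; do ?by nz.
move/eqP: H; rewrite -subr_eq0 => /eqP H.
apply/eqP; rewrite -subr_eq0; apply/eqP; rewrite -[RHS](mulr0 z) -H; fld.
Qed.

Lemma theta_rel12 :
  th (D / (x * y * u)) * th (u * v) * th (v * x) * th (D / y)
  = v * th x * th (v * D / y) * th (D / (x * y * (u * v))) * th u
  + th v * th (D / (y * u)) * th (D / (x * y)) * th (u * v * x).
Proof.
have [n1 n2 n3 n4] : [/\ D / (x * y * u) != 0, u * v != 0, v * x != 0 & D / y != 0].
  by split; nz.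
have sq : (v * D / y) ^+ 2 = (D / (x * y * u)) * (u * v) * (v * x) * (D / y) by fld.
have H := thW n1 n2 n3 n4 sq.
rewrite (_ : v * D / y / (D / (x * y * u)) = u * v * x) in H; last by fld.
rewrite (_ : v * D / y / (u * v) = D / (y * u)) in H; last by fld.
rewrite (_ : v * D / y / (v * x) = D / (x * y)) in H; last by fld.
rewrite (_ : v * D / y / (D / y) = v) in H; last by fld.
rewrite (_ : v * D / y / (v * x * (D / y)) = 1 / x) in H; last by fld.
rewrite (_ : v * D / y / (u * v * (D / y)) = 1 / u) in H; last by fld.
rewrite (_ : v * D / y / (u * v * (v * x)) = D / (x * y * (u * v))) in H; last by fld.
rewrite (@th1V x) in H; do ?by nz.
rewrite (@th1V u) in H; do ?by nz.
move/eqP: H; rewrite -subr_eq0 => /eqP H.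
apply/eqP; rewrite -subr_eq0; apply/eqP; rewrite -[RHS](mulr0 1) -H; fld.
Qed.

Lemma theta_rel21 :
  z * th (u * v * x / z) * th (D / (x * z * v)) * th (D / y) * th (u * y)
  = u * y * th (v * x / y) * th z * th (D / (x * y * (u * v))) * th (u * D / z)
  + z * th (D / (x * v)) * th (D / (y * z)) * th (u * y / z) * th (u * v * x).
Proof.
have [n1 n2 n3 n4] : [/\ u * v * x / z != 0, D / (x * z * v) != 0, D / y != 0 & u * y
  != 0].
  by split; nz.
have sq : (u * D / z) ^+ 2 = (u * v * x / z) * (D / (x * z * v)) * (D / y) * (u * y)
  by fld.
have H := thW n1 n2 n3 n4 sq.
rewrite (_ : u * D / z / (u * v * x / z) = D / (x * v)) in H; last by fld.
rewrite (_ : u * D / z / (D / (x * z * v)) = u * v * x) in H; last by fld.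
rewrite (_ : u * D / z / (D / y) = u * y / z) in H; last by fld.
rewrite (_ : u * D / z / (u * y) = D / (y * z)) in H; last by fld.
rewrite (_ : u * D / z / (D / y * (u * y)) = 1 / z) in H; last by fld.
rewrite (_ : u * D / z / (D / (x * z * v) * (u * y)) = v * x / y) in H; last by fld.
rewrite (_ : u * D / z / (D / (x * z * v) * (D / y)) = x * y * (u * v) / D) in H;
  last by fld.
rewrite (@th1V z) in H; do ?by nz.
rewrite (@thVM (x * y * (u * v)) D) in H; do ?by nz.
move/eqP: H; rewrite -subr_eq0 => /eqP H.
apply/eqP; rewrite -subr_eq0; apply/eqP; rewrite -[RHS](mulr0 z) -H; fld.
Qed.

Lemma theta_rel22 :
  th (D / (x * (u * v))) * th (D / y) * th (v * x) * th (u * y)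
  = y * th D * th (v * x / y) * th (D / (x * y * (u * v))) * th u
  + th y * th (D / (x * v)) * th (D / (y * u)) * th (u * v * x).
Proof.
have [n1 n2 n3 n4] : [/\ D / (x * (u * v)) != 0, D / y != 0, v * x != 0 & u * y != 0].
  by split; nz.
have sq : (D) ^+ 2 = (D / (x * (u * v))) * (D / y) * (v * x) * (u * y) by fld.
have H := thW n1 n2 n3 n4 sq.
rewrite (_ : D / (D / (x * (u * v))) = u * v * x) in H; last by fld.
rewrite (_ : D / (D / y) = y) in H; last by fld.
rewrite (_ : D / (v * x) = D / (x * v)) in H; last by fld.
rewrite (_ : D / (u * y) = D / (y * u)) in H; last by fld.
rewrite (_ : D / (v * x * (u * y)) = D / (x * y * (u * v))) in H; last by fld.
rewrite (_ : D / (D / y * (u * y)) = 1 / u) in H; last by fld.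
rewrite (_ : D / (D / y * (v * x)) = y / (v * x)) in H; last by fld.
rewrite (@th1V u) in H; do ?by nz.
rewrite (@thVM y (v * x)) in H; do ?by nz.
move/eqP: H; rewrite -subr_eq0 => /eqP H.
apply/eqP; rewrite -subr_eq0; apply/eqP; rewrite -[RHS](mulr0 1) -H; fld.
Qed.

(** theta(D^2/(xyz)) is foreign to the (1,1) equation. It occurs on the right of this relation and
    of [theta_rel11b], and is eliminated between them. *)
Lemma theta_rel11a :
  th (D / (x * y * z)) * th (D / x) * th (D / y) * th (D / z)
  - th D * th (D / (y * z)) * th (D / (x * z)) * th (D / (x * y))
  = - (D / (x * y * z)) * th (D ^+ 2 / (x * y * z)) * th x * th y * th z.
Proof.
have [n1 n2 n3 n4] : [/\ D / (x * y * z) != 0, D / x != 0, D / y != 0 & D / z != 0].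
  by split; nz.
have sq : (D ^+ 2 / (x * y * z)) ^+ 2 = (D / (x * y * z)) * (D / x) * (D / y) * (D /
  z) by fld.
have H := thW n1 n2 n3 n4 sq.
rewrite (_ : D ^+ 2 / (x * y * z) / (D / (x * y * z)) = D) in H; last by fld.
rewrite (_ : D ^+ 2 / (x * y * z) / (D / x) = D / (y * z)) in H; last by fld.
rewrite (_ : D ^+ 2 / (x * y * z) / (D / y) = D / (x * z)) in H; last by fld.
rewrite (_ : D ^+ 2 / (x * y * z) / (D / z) = D / (x * y)) in H; last by fld.
rewrite (_ : D ^+ 2 / (x * y * z) / (D / y * (D / z)) = 1 / x) in H; last by fld.
rewrite (_ : D ^+ 2 / (x * y * z) / (D / x * (D / z)) = 1 / y) in H; last by fld.
rewrite (_ : D ^+ 2 / (x * y * z) / (D / x * (D / y)) = 1 / z) in H; last by fld.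
rewrite (@th1V x) in H; do ?by nz.
rewrite (@th1V y) in H; do ?by nz.
rewrite (@th1V z) in H; do ?by nz.
move/eqP: H; rewrite -subr_eq0 => /eqP H.
apply/eqP; rewrite -subr_eq0; apply/eqP; rewrite -[RHS](mulr0 1) -H; fld.
Qed.

Lemma theta_rel11b :
  th (D / (x * y * u)) * th (u * v * D / z) * th (D / (x * z * v)) * th (D / y)
  - th (u * D / z) * th (D / (x * y * (u * v))) * th (v * D / y) * th (D / (x * z))
  = D / (x * y * (u * v)) * th (D ^+ 2 / (x * y * z))
    * th v * th (u * v * x) * th (u * y / z).
Proof.
have [n1 n2 n3 n4] : [/\ D / (x * y * u) != 0, u * v * D / z != 0, D / (x * z * v) != 0
  & D / y != 0].
  by split; nz.
have sq : (D ^+ 2 / (x * y * z)) ^+ 2 = (D / (x * y * u)) * (u * v * D / z) * (D / (x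
  * z * v)) * (D / y) by fld.
have H := thW n1 n2 n3 n4 sq.
rewrite (_ : D ^+ 2 / (x * y * z) / (D / (x * y * u)) = u * D / z) in H; last by fld.
rewrite (_ : D ^+ 2 / (x * y * z) / (u * v * D / z) = D / (x * y * (u * v))) in H;
  last by fld.
rewrite (_ : D ^+ 2 / (x * y * z) / (D / (x * z * v)) = v * D / y) in H; last by fld.
rewrite (_ : D ^+ 2 / (x * y * z) / (D / y) = D / (x * z)) in H; last by fld.
rewrite (_ : D ^+ 2 / (x * y * z) / (D / (x * z * v) * (D / y)) = v) in H; last by
  fld.
rewrite (_ : D ^+ 2 / (x * y * z) / (u * v * D / z * (D / y)) = 1 / (u * v * x)) in
  H; last by fld.
rewrite (_ : D ^+ 2 / (x * y * z) / (u * v * D / z * (D / (x * z * v))) = z / (u *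
  y)) in H; last by fld.
rewrite (@th1V (u * v * x)) in H; do ?by nz.
rewrite (@thVM z (u * y)) in H; do ?by nz.
move/eqP: H; rewrite -subr_eq0 => /eqP H.
apply/eqP; rewrite -subr_eq0; apply/eqP; rewrite -[RHS](mulr0 1) -H; fld.
Qed.

(** [th] is opaque to [field], so equal arguments must also be written alike; these rules normalise
    those in which [D] has absorbed a parameter. *)
Let canon0 : u * (D / x) / z = u * D / (x * z). Proof. fld. Qed.
Let canon1 : D / x / z = D / (x * z). Proof. fld. Qed.
Let canon2 : D / x / (y * z) = D / (x * y * z). Proof. fld. Qed.
Let canon3 : D / x / y = D / (x * y). Proof. fld. Qed.
Let canon4 : D / x / (y * u) = D / (x * y * u). Proof. fld. Qed.
Let canon5 : v * (D / z) / y = v * D / (y * z). Proof. fld. Qed.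
Let canon6 : D / z / y = D / (y * z). Proof. fld. Qed.
Let canon7 : D / z / (x * y) = D / (x * y * z). Proof. fld. Qed.
Let canon8 : D / z / x = D / (x * z). Proof. fld. Qed.
Let canon9 : D / z / (x * v) = D / (x * z * v). Proof. fld. Qed.
Let canon10 : u * v * (D / y) / z = u * v * D / (y * z). Proof. fld. Qed.
Let canon11 : D / y / z = D / (y * z). Proof. fld. Qed.
Let canon12 : D / y / (x * z) = D / (x * y * z). Proof. fld. Qed.
Let canon13 : D / y / x = D / (x * y). Proof. fld. Qed.
Let canon14 : D / y / (x * (u * v)) = D / (x * y * (u * v)). Proof. fld. Qed.
Let canon := ((canon0, canon1, canon2, canon3, canon4, canon5, canon6, canon7),
  (canon8, canon9, canon10, canon11, canon12, canon13, canon14)).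

(** The matrices at position r count the third parameter as part of the tail, hence [D / x],
    [D / y], [D / z]; those at position r+1 see [D]. *)
Lemma core_ybe00 :
  core00 u y z (D / x) * core00 v x y (D / z) + core01 u y z * core00 (u * v) x z D *
    core10 v x y (D / z)
  = core00 (u * v) x z (D / y).
Proof.
have H := theta_rel00; move/eqP: H; rewrite -subr_eq0 => /eqP H.
rewrite /core00 /core01 /core10 /core11 !canon (thE y) in H *.
apply/eqP; rewrite -subr_eq0; apply/eqP.
rewrite -[RHS](mulr0 (poch (q / z) * poch x / (th (D / (x * z)) * th (u * y) * th (D /
  (y * z)) * th (v * x) * th (u * v * x)))) -H; fld.
Qed.

(** Here and in the next equations the explicit [u] and [v] are what remains of the factor [w] in
    [gauged11] after a common power is divided out. *)
Lemma core_ybe01 :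
  core00 u y z (D / x) * core01 v x y + v * (core01 u y z * core00 (u * v) x z D *
    core11 v x y (D / z))
  = core01 (u * v) x z * core00 u y z D.
Proof.
have H := theta_rel01; move/eqP: H; rewrite -subr_eq0 => /eqP H.
rewrite /core00 /core01 /core10 /core11 !canon (thE x) in H *.
apply/eqP; rewrite -subr_eq0; apply/eqP.
rewrite -[RHS](mulr0 (poch (q / z) * poch y / (th (D / (x * z)) * th (u * y) * th (v *
  x) * th (D / z) * th (u * v * x)))) -H; fld.
Qed.

Lemma core_ybe10 :
  core10 u y z (D / x) * core00 v x y (D / z) + u * (core11 u y z (D / x) * core00 (u *
    v) x z D * core10 v x y (D / z))
  = core00 v x y D * core10 (u * v) x z (D / y).
Proof.
have H := theta_rel10; move/eqP: H; rewrite -subr_eq0 => /eqP H.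
rewrite /core00 /core01 /core10 /core11 !canon (thE z) in H *.
apply/eqP; rewrite -subr_eq0; apply/eqP.
rewrite -[RHS](mulr0 (poch (q / y) * poch x * th (D / (x * y * z)) / (th (D / (x * y))
  * th (D / (y * z)) * th (v * x) * th (D / (x * z)) * th (u * y) * th (u * v * x))))
  -H; fld.
Qed.

Lemma core_ybe12 :
  core11 u y z (D / x) * core01 (u * v) x z
  = v * (core00 v x y D * core11 (u * v) x z (D / y) * core01 u y z) + core01 v x y *
    core11 u y z D.
Proof.
have H := theta_rel12; move/eqP: H; rewrite -subr_eq0 => /eqP H.
rewrite /core00 /core01 /core10 /core11 !canon (thE x) in H *.
apply/eqP; rewrite -subr_eq0; apply/eqP.
rewrite -[RHS](mulr0 (poch (q / y) * poch z / (th (u * y) * th (D / (x * y)) * th (u *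
  v * x) * th (v * x) * th (D / y)))) -H; fld.
Qed.

Lemma core_ybe21 :
  core10 (u * v) x z D * core11 v x y (D / z)
  = u * (core10 v x y D * core11 (u * v) x z (D / y) * core00 u y z D) + core11 v x y D
    * core10 u y z D.
Proof.
have H := theta_rel21; move/eqP: H; rewrite -subr_eq0 => /eqP H.
rewrite /core00 /core01 /core10 /core11 !canon (thE z) in H *.
apply/eqP; rewrite -subr_eq0; apply/eqP.
rewrite -[RHS](mulr0 (poch (q / x) * poch y * th D / (th (D / x) * th (D / z) * th (v *
  x) * th (u * v * x) * th (D / y) * th (u * y)))) -H; fld.
Qed.

Lemma core_ybe22 :
  core11 (u * v) x z D
  = core10 v x y D * core11 (u * v) x z (D / y) * core01 u y z + core11 v x y D *
    core11 u y z D.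
Proof.
have H := theta_rel22; move/eqP: H; rewrite -subr_eq0 => /eqP H.
rewrite /core00 /core01 /core10 /core11 !canon (thE y) in H *.
apply/eqP; rewrite -subr_eq0; apply/eqP.
rewrite -[RHS](mulr0 (poch (q / x) * poch z / (th (D / x) * th (u * v * x) * th (D / y)
  * th (v * x) * th (u * y)))) -H; fld.
Qed.

Lemma core_ybe02 :
  core01 u y z * core01 (u * v) x z = core01 (u * v) x z * core01 u y z.
Proof. by rewrite /core01 mulrC. Qed.

Lemma core_ybe20 :
  core10 (u * v) x z D * core10 v x y (D / z) = core10 v x y D * core10 (u * v) x z (D
    / y).
Proof. by rewrite /core10 !canon; fld. Qed.

Lemma core_ybe11 :
  core10 u y z (D / x) * core01 v x y + u * v * (core11 u y z (D / x) * core00 (u * v)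
    x z D * core11 v x y (D / z))
  = u * v * (core00 v x y D * core11 (u * v) x z (D / y) * core00 u y z D) + core01 v x
    y * core10 u y z D.
Proof.
have H := theta_rel11a; move/eqP: H; rewrite -subr_eq0 => /eqP H.
have H' := theta_rel11b; move/eqP: H'; rewrite -subr_eq0 => /eqP H'.
(* With these multipliers the right-hand sides of the two relations cancel: z D/(xyz) and uv
   D/(xyuv) both equal D/(xy), and the signs are opposite. *)
have H'' : z * th v * th (u * y / z) * th (u * v * x) / (th (v * x) * th (u * y) * th
  (u * v * x) * th (D / (x * y)) * th (D / (x * z)) * th (D / y) * th (D / z)) * 0
   + u * v * (th x * th y * th z) / (th (v * x) * th (u * y) * th (u * v * x) * th (D /
     (x * y)) * th (D / (x * z)) * th (D / y) * th (D / z)) * 0 = 0 by rewrite !mulr0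
     addr0.
rewrite -{1}H -{1}H' in H''.
rewrite /core00 /core01 /core10 /core11 !canon in H'' *.
rewrite (thE x) (thE y) (thE z) in H''.
apply/eqP; rewrite -subr_eq0; apply/eqP; rewrite -H''; fld.
Qed.

Variables f0 f1 f2 a0 a1 b1 i0 i1 i2 c1 c2 d1 Ua Ub Uz UG Va Vb Vz VG : K.
Hypotheses (nf0 : f0 != 0) (nf1 : f1 != 0) (nf2 : f2 != 0) (na0 : a0 != 0) (na1 : a1 !=
  0) (nb1 : b1 != 0) (ni0 : i0 != 0) (ni1 : i1 != 0) (ni2 : i2 != 0) (nc1 : c1 != 0)
  (nc2 : c2 != 0) (nd1 : d1 != 0) (nUa : Ua != 0) (nUb : Ub != 0) (nUz : Uz != 0) (nUG
  : UG != 0) (nVa : Va != 0) (nVb : Vb != 0) (nVz : Vz != 0) (nVG : VG != 0).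
Ltac nzn := nz; rewrite ?(nf0, nf1, nf2, na0, na1, nb1, ni0, ni1, ni2, nc1, nc2, nd1,
  nUa, nUb, nUz, nUG, nVa, nVb, nVz, nVG) //=.

(** In every term the inner gauge factors cancel, leaving f0/i0, and the powers of u and v are the
    same; what is left is the core identity. The other entries follow the same pattern. *)
Lemma gauged_ybe00 :
  gauged00 u y z (D / x) f0 a0 Ub Uz (UG / Ua) * gauged00 v x y (D / z) a0 i0 Va Vb (VG
    / Vz)
  + gauged01 u y z f0 b1 Ub * gauged00 (u * v) x z D b1 a1 (Ua * Va) (Uz * Vz) (UG *
    VG) * gauged10 v x y (D / z) a1 i0 Vb
  = gauged00 (u * v) x z (D / y) f0 i0 (Ua * Va) (Uz * Vz) (UG * VG / (Ub * Vb)).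
Proof.
have := core_ybe00.
rewrite /gauged00 /gauged01 /gauged10 /gauged11; move: (core00 u y z (D / x)) (core00 v
  x y (D / z)) (core01 u y z) (core00 (u * v) x z D) (core10 v x y (D / z)) (core00 (u
  * v) x z (D / y)) => e0 e1 e2 e3 e4 e5 H.
move/eqP: H; rewrite -subr_eq0 => /eqP H.
apply/eqP; rewrite -subr_eq0; apply/eqP.
rewrite -[RHS](mulr0 (f0 / i0 * (UG * VG / (Ua * Ub * Uz * (Va * Vb * Vz))))) -H;
  field; nzn.
Qed.

Lemma gauged_ybe01 :
  gauged00 u y z (D / x) f0 a0 Ub Uz (UG / Ua) * gauged01 v x y a0 i1 Va
  + gauged01 u y z f0 b1 Ub * gauged00 (u * v) x z D b1 a1 (Ua * Va) (Uz * Vz) (UG *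
    VG) * gauged11 v x y (D / z) a1 i1 (VG / Vz)
  = gauged01 (u * v) x z f0 c1 (Ua * Va) * gauged00 u y z D c1 i1 Ub Uz UG.
Proof.
have := core_ybe01.
rewrite /gauged00 /gauged01 /gauged10 /gauged11; move: (core00 u y z (D / x)) (core01 v
  x y) (core01 u y z) (core00 (u * v) x z D) (core11 v x y (D / z)) (core01 (u * v) x
  z) (core00 u y z D) => e0 e1 e2 e3 e4 e5 e6 H.
move/eqP: H; rewrite -subr_eq0 => /eqP H.
apply/eqP; rewrite -subr_eq0; apply/eqP.
rewrite -[RHS](mulr0 (f0 / i1 * (UG / (Ua * Ub * Uz) / Va))) -H; field; nzn.
Qed.

Lemma gauged_ybe02 :
  gauged01 u y z f0 b1 Ub * gauged01 (u * v) x z b1 i2 (Ua * Va)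
  = gauged01 (u * v) x z f0 c1 (Ua * Va) * gauged01 u y z c1 i2 Ub.
Proof.
have := core_ybe02.
rewrite /gauged00 /gauged01 /gauged10 /gauged11; move: (core01 u y z) (core01 (u * v) x
  z) => e0 e1 H.
move/eqP: H; rewrite -subr_eq0 => /eqP H.
apply/eqP; rewrite -subr_eq0; apply/eqP.
rewrite -[RHS](mulr0 (f0 / i2 / (Ua * Ub * Va))) -H; field; nzn.
Qed.

Lemma gauged_ybe10 :
  gauged10 u y z (D / x) f1 a0 Uz * gauged00 v x y (D / z) a0 i0 Va Vb (VG / Vz)
  + gauged11 u y z (D / x) f1 b1 (UG / Ua) * gauged00 (u * v) x z D b1 a1 (Ua * Va) (Uz
    * Vz) (UG * VG) * gauged10 v x y (D / z) a1 i0 Vb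
  = gauged00 v x y D f1 d1 Va Vb VG * gauged10 (u * v) x z (D / y) d1 i0 (Uz * Vz).
Proof.
have := core_ybe10.
rewrite /gauged00 /gauged01 /gauged10 /gauged11; move: (core10 u y z (D / x)) (core00 v
  x y (D / z)) (core11 u y z (D / x)) (core00 (u * v) x z D) (core10 v x y (D / z))
  (core00 v x y D) (core10 (u * v) x z (D / y)) => e0 e1 e2 e3 e4 e5 e6 H.
move/eqP: H; rewrite -subr_eq0 => /eqP H.
apply/eqP; rewrite -subr_eq0; apply/eqP.
rewrite -[RHS](mulr0 (f1 / i0 * (VG / (Va * Vb * Vz) / Uz))) -H; field; nzn.
Qed.

Lemma gauged_ybe11 :
  gauged10 u y z (D / x) f1 a0 Uz * gauged01 v x y a0 i1 Va
  + gauged11 u y z (D / x) f1 b1 (UG / Ua) * gauged00 (u * v) x z D b1 a1 (Ua * Va) (Uz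
    * Vz) (UG * VG) * gauged11 v x y (D / z) a1 i1 (VG / Vz)
  = gauged00 v x y D f1 d1 Va Vb VG * gauged11 (u * v) x z (D / y) d1 c1 (UG * VG / (Ub
    * Vb)) * gauged00 u y z D c1 i1 Ub Uz UG
  + gauged01 v x y f1 c2 Va * gauged10 u y z D c2 i1 Uz.
Proof.
have := core_ybe11.
rewrite /gauged00 /gauged01 /gauged10 /gauged11; move: (core10 u y z (D / x)) (core01 v
  x y) (core11 u y z (D / x)) (core00 (u * v) x z D) (core11 v x y (D / z)) (core00 v x
  y D) (core11 (u * v) x z (D / y)) (core00 u y z D) (core10 u y z D) => e0 e1 e2 e3 e4
  e5 e6 e7 e8 H.
move/eqP: H; rewrite -subr_eq0 => /eqP H.
apply/eqP; rewrite -subr_eq0; apply/eqP.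
rewrite -[RHS](mulr0 (f1 / i1 / (Uz * Va))) -H; field; nzn.
Qed.

Lemma gauged_ybe12 :
  gauged11 u y z (D / x) f1 b1 (UG / Ua) * gauged01 (u * v) x z b1 i2 (Ua * Va)
  = gauged00 v x y D f1 d1 Va Vb VG * gauged11 (u * v) x z (D / y) d1 c1 (UG * VG / (Ub
    * Vb)) * gauged01 u y z c1 i2 Ub
  + gauged01 v x y f1 c2 Va * gauged11 u y z D c2 i2 UG.
Proof.
have := core_ybe12.
rewrite /gauged00 /gauged01 /gauged10 /gauged11; move: (core11 u y z (D / x)) (core01
  (u * v) x z) (core00 v x y D) (core11 (u * v) x z (D / y)) (core01 u y z) (core01 v x
  y) (core11 u y z D) => e0 e1 e2 e3 e4 e5 e6 H.
move/eqP: H; rewrite -subr_eq0 => /eqP H.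
apply/eqP; rewrite -subr_eq0; apply/eqP.
rewrite -[RHS](mulr0 (f1 / i2 * (u / (UG * Va)))) -H; field; nzn.
Qed.

Lemma gauged_ybe20 :
  gauged10 (u * v) x z D f2 a1 (Uz * Vz) * gauged10 v x y (D / z) a1 i0 Vb
  = gauged10 v x y D f2 d1 Vb * gauged10 (u * v) x z (D / y) d1 i0 (Uz * Vz).
Proof.
have := core_ybe20.
rewrite /gauged00 /gauged01 /gauged10 /gauged11; move: (core10 (u * v) x z D) (core10 v
  x y (D / z)) (core10 v x y D) (core10 (u * v) x z (D / y)) => e0 e1 e2 e3 H.
move/eqP: H; rewrite -subr_eq0 => /eqP H.
apply/eqP; rewrite -subr_eq0; apply/eqP.
rewrite -[RHS](mulr0 (f2 / i0 / (Uz * Vz * Vb))) -H; field; nzn.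
Qed.

Lemma gauged_ybe21 :
  gauged10 (u * v) x z D f2 a1 (Uz * Vz) * gauged11 v x y (D / z) a1 i1 (VG / Vz)
  = gauged10 v x y D f2 d1 Vb * gauged11 (u * v) x z (D / y) d1 c1 (UG * VG / (Ub *
    Vb)) * gauged00 u y z D c1 i1 Ub Uz UG
  + gauged11 v x y D f2 c2 VG * gauged10 u y z D c2 i1 Uz.
Proof.
have := core_ybe21.
rewrite /gauged00 /gauged01 /gauged10 /gauged11; move: (core10 (u * v) x z D) (core11 v
  x y (D / z)) (core10 v x y D) (core11 (u * v) x z (D / y)) (core00 u y z D) (core11 v
  x y D) (core10 u y z D) => e0 e1 e2 e3 e4 e5 e6 H.
move/eqP: H; rewrite -subr_eq0 => /eqP H.
apply/eqP; rewrite -subr_eq0; apply/eqP.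
rewrite -[RHS](mulr0 (f2 / i1 * (v / (VG * Uz)))) -H; field; nzn.
Qed.

Lemma gauged_ybe22 :
  gauged11 (u * v) x z D f2 i2 (UG * VG)
  = gauged10 v x y D f2 d1 Vb * gauged11 (u * v) x z (D / y) d1 c1 (UG * VG / (Ub *
    Vb)) * gauged01 u y z c1 i2 Ub
  + gauged11 v x y D f2 c2 VG * gauged11 u y z D c2 i2 UG.
Proof.
have := core_ybe22.
rewrite /gauged00 /gauged01 /gauged10 /gauged11; move: (core11 (u * v) x z D) (core10 v
  x y D) (core11 (u * v) x z (D / y)) (core01 u y z) (core11 v x y D) (core11 u y z D)
  => e0 e1 e2 e3 e4 e5 H.
move/eqP: H; rewrite -subr_eq0 => /eqP H.
apply/eqP; rewrite -subr_eq0; apply/eqP.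
rewrite -[RHS](mulr0 (f2 / i2 * (u * v / (UG * VG)))) -H; field; nzn.
Qed.

End CoreYangBaxter.

(** * The entries of one block in gauged form *)

Section EntryNormalForm.
Variables (K : fieldType) (q : K) (poch th : K -> K).
Hypothesis q0 : q != 0.
Hypothesis pochE : forall x, poch x = (1 - x) * poch (x * q).
Hypothesis thE : forall x, th x = poch x * poch (q / x).
Hypothesis thM : forall x, x != 0 -> th (q * x) = - x^-1 * th x.

(** The Pochhammer values attached to [Y] in the denominators and in the gauge factors; all are
    nonzero when [Y] is not an integral power of [q]. *)
Definition poch_unit (Y : K) :=
  [/\ poch Y != 0, poch (q / Y) != 0, poch (Y / q) != 0 & poch (q ^+ 2 / Y) != 0].

Variables w a b D A B G : K.
Hypotheses (w0 : w != 0) (a0 : a != 0) (b0 : b != 0) (D0 : D != 0).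
Hypotheses (A0 : A != 0) (B0 : B != 0) (G0 : G != 0).
Hypotheses (hD : poch_unit D) (hDa : poch_unit (D / a)) (hDb : poch_unit (D / b)).
Hypothesis (hDab : poch_unit (D / (a * b))).
Hypothesis twa : th (w * a) != 0.

(** The row factors, ending in [o], belong to the list with [a] and [b] exchanged; the column
    factors, ending in [i], to the list itself. *)
Let n0o := poch (q * (a * b) / D) / poch (q ^+ 2 * a / D).
Let n0i := poch (q * (a * b) / D) / poch (q ^+ 2 * b / D).
Let n1o := poch (q * a / D) / poch (q ^+ 2 / D).
Let n1i := poch (q * b / D) / poch (q ^+ 2 / D).

Let pDa : poch (q * a / D) != 0.
Proof. by have [_ + _ _] := hDa; rewrite invf_div mulrA. Qed.
Let pDb : poch (q * b / D) != 0.
Proof. by have [_ + _ _] := hDb; rewrite invf_div mulrA. Qed.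
Let pDab : poch (q * (a * b) / D) != 0.
Proof. by have [_ + _ _] := hDab; rewrite invf_div mulrA. Qed.
Let ppDa : poch (q ^+ 2 * a / D) != 0.
Proof. by have [_ _ _ +] := hDa; rewrite invf_div mulrA. Qed.
Let ppDb : poch (q ^+ 2 * b / D) != 0.
Proof. by have [_ _ _ +] := hDb; rewrite invf_div mulrA. Qed.
Let pqDb : poch (D / (q * b)) != 0.
Proof. by have [_ _ + _] := hDb; rewrite -mulrA -invfM (mulrC b). Qed.

Let stepDb : poch (D / (q * b)) = (1 - D / (q * b)) * poch (D / b).
Proof. by rewrite pochE; congr (_ * poch _); field; rewrite b0 q0. Qed.
Let step_qb : poch (q * b / D) = (1 - q * b / D) * poch (q ^+ 2 * b / D).
Proof. by rewrite pochE; congr (_ * poch _); field. Qed.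
Let stepD : poch (D / q) = (1 - D / q) * poch D.
Proof. by rewrite pochE; congr (_ * poch _); field. Qed.
Let step_q : poch (q / D) = (1 - q / D) * poch (q ^+ 2 / D).
Proof. by rewrite pochE; congr (_ * poch _); field. Qed.

(** Otherwise (D/(qb))_oo would contain the factor 0; [field] needs this to cancel 1 - D/(qb). *)
Let qbD : q * b - D != 0.
Proof.
apply: contra_neq pqDb => E; rewrite stepDb (_ : D = q * b); last first.
  by apply/eqP; rewrite eq_sym -subr_eq0 E.
by rewrite divff ?mulf_neq0 // subrr mul0r.
Qed.

Let Dqb : D - q * b != 0.
Proof. by rewrite -oppr_eq0 opprB. Qed.

Let thDa : th (D / a) = poch (D / a) * poch (q * a / D).
Proof. by rewrite thE invf_div mulrA. Qed.
Let thDb : th (D / b) = poch (D / b) * poch (q * b / D).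
Proof. by rewrite thE invf_div mulrA. Qed.
Let thDab : th (D / (a * b)) = poch (D / (a * b)) * poch (q * (a * b) / D).
Proof. by rewrite thE invf_div mulrA. Qed.

Ltac nf := rewrite ?(q0, w0, a0, b0, D0, A0, B0, G0, twa, qbD, Dqb, pDa, pDb, pDab,
  ppDa, ppDb, pqDb) //=.

(** The quasi-periodicity that turns theta(wD/(qb)) into theta(wD/b) releases a factor w, which
    absorbs the extra [w^-1] of this entry. *)
Lemma gauged00E :
  poch (q / b) * poch a / (poch (q ^+ 2 * a / D) * poch (D / (q * b)))
  * (th (w * D / (q * b)) / th (w * a)) * (w^-1 * (G / (A * B)))
  = gauged00 q poch th w a b D n0o n0i A B G.
Proof.
have [pb _ _ _] := hDb.
have -> : th (w * D / (q * b)) = - (w * D / (q * b)) * th (w * D / b).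
  have -> : w * D / b = q * (w * D / (q * b)) by field; rewrite q0 b0.
  rewrite thM; first by field; rewrite q0 b0 w0 D0.
  by rewrite !mulf_neq0 ?invr_eq0 ?mulf_neq0.
rewrite /gauged00 /core00 thDb /n0o /n0i stepDb step_qb.
move: (th (w * D / b)) (poch (q / b)) (poch a) => t1 r1 r2.
field; nf; rewrite ?pb //.
Qed.

Lemma gauged01E :
  poch (q ^+ 2 / D) * poch (q * (a * b) / D)
  / (poch (q ^+ 2 * a / D) * poch (q * b / D)) * (th w / th (w * a)) * A^-1
  = gauged01 th w a b n0o n1i A.
Proof.
have [_ _ _ ppD] := hD.
rewrite /gauged01 /core01 /n0o /n1i; field; nf; rewrite ?ppD //.
Qed.

(** The factor b in [core10] is the product of (1 - D/q)/(1 - q/D) = -D/q and (1 - qb/D)/(1 -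
    D/(qb)) = -qb/D, left over by the shifts of Pochhammer arguments by q. *)
Lemma gauged10E :
  poch (D / (a * b)) * poch (D / q) / (poch (D / a) * poch (D / (q * b)))
  * (th (w * a / b) / th (w * a)) * B^-1
  = gauged10 th w a b D n1o n0i B.
Proof.
have [pD pqD _ ppD] := hD; have [pa _ _ _] := hDa; have [pb _ _ _] := hDb.
have [pab _ _ _] := hDab.
rewrite /gauged10 /core10 thDa thDb thDab (thE D) /n1o /n0i stepDb step_qb step_q stepD.
move: (th (w * a / b)) => t1.
field; nf; rewrite ?pa ?pb ?ppD //.
Qed.

Lemma gauged11E :
  poch (q / a) * poch b / (poch (D / a) * poch (q * b / D))
  * (th (w * q * a / D) / th (w * a)) * (w / G)
  = gauged11 q poch th w a b D n1o n1i G.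
Proof.
have [_ _ _ ppD] := hD; have [pa _ _ _] := hDa.
have -> : th (w * q * a / D) = th (D / (a * w)).
  rewrite !thE mulrC; congr (poch _ * poch _); field; nf.
rewrite /gauged11 /core11 thDa /n1o /n1i.
move: (th (D / (a * w))) (poch (q / a)) (poch b) => t1 r1 r2.
field; nf; rewrite ?pa ?ppD //.
Qed.

End EntryNormalForm.

(** * The matrices *)

Section ComplexPowers.
Context {R : realType}.
Local Notation C := R[i].

Lemma expCD (a b : C) : expC (a + b) = expC a * expC b.
Proof.
case: a => a1 a2; case: b => b1 b2; rewrite /expC /= expRD cosD sinD.
by simpc; congr Complex; ring.
Qed.

Lemma expC0 : expC (0 : C) = 1.
Proof. by rewrite /expC /= expR0 cos0 sin0; simpc. Qed.

Lemma expC_neq0 (a : C) : expC a != 0.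
Proof.
apply/eqP => a0; have := expCD a (- a); rewrite subrr expC0 a0 mul0r.
by move/eqP; rewrite oner_eq0.
Qed.

Lemma expCN (a : C) : expC (- a) = (expC a)^-1.
Proof.
by apply: (mulfI (expC_neq0 a)); rewrite -expCD subrr expC0 divff ?expC_neq0.
Qed.

Lemma powC_neq0 (l d : C) : powC l d != 0.
Proof. exact: expC_neq0. Qed.

Lemma powCD (l a b : C) : powC l (a + b) = powC l a * powC l b.
Proof. by rewrite /powC mulrDl expCD. Qed.

Lemma powCN (l a : C) : powC l (- a) = (powC l a)^-1.
Proof. by rewrite /powC mulNr expCN. Qed.

Lemma powC1 (l : C) : powC l 1 = expC l.
Proof. by rewrite /powC mul1r. Qed.

Lemma powC_addl (l m a : C) : powC (l + m) a = powC l a * powC m a.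
Proof. by rewrite /powC mulrDr expCD. Qed.

End ComplexPowers.

Section Tails.
Context {R : realType} (M : nat).
Local Notation C := R[i].
Implicit Types f : 'I_M -> C.

Lemma tail_prodS f i (h : (i < M)%N) :
  tail_prod f i = f (Ordinal h) * tail_prod f i.+1.
Proof.
rewrite /tail_prod (bigD1 (Ordinal h)) //=; congr (_ * _).
by apply: eq_bigl => j; rewrite ltn_neqAle andbC eq_sym.
Qed.

Lemma tail_sumS f i (h : (i < M)%N) :
  tail_sum f i = f (Ordinal h) + tail_sum f i.+1.
Proof.
rewrite /tail_sum (bigD1 (Ordinal h)) //=; congr (_ + _).
by apply: eq_bigl => j; rewrite ltn_neqAle andbC eq_sym.
Qed.

Lemma tail_prod_perm f (s : 'S_M) i :
  (forall j : 'I_M, (i <= j)%N -> s j = j) ->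
  tail_prod (fun j => f (s j)) i = tail_prod f i.
Proof. by move=> H; apply: eq_bigr => j /H ->. Qed.

Lemma tail_sum_perm f (s : 'S_M) i :
  (forall j : 'I_M, (i <= j)%N -> s j = j) ->
  tail_sum (fun j => f (s j)) i = tail_sum f i.
Proof. by move=> H; apply: eq_bigr => j /H ->. Qed.

Lemma tail_prod_neq0 f i : (forall j, f j != 0) -> tail_prod f i != 0.
Proof. by move=> H; apply/prodf_neq0 => j _. Qed.

End Tails.

(** * Nonvanishing of the denominators, and the entries of [Stilde] *)

Section StildeEntries.
Context {R : realType}.
Local Notation C := R[i].
Variable q : C.
Hypothesis q1 : normc q < 1.
Hypothesis q0 : q != 0.

Lemma qpoch_unit (y : C) : y != 0 -> ~ qZ q y -> poch_unit q (qpoch q) y.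
Proof.
move=> y0 H.
(* A vanishing factor would make [y] or its inverse a power of [q]. The components of [poch_unit]
   are the cases n = 0, 1, -1, 2. *)
have key (n : int) (k : nat) (b : bool) : (y ^ (if b then 1 else -1)) * q ^ n * q ^+ k
  != 1.
  apply/eqP => E; apply: H; rewrite /qZ /=.
  have {}E : y ^ (if b then 1 else -1) = q ^ (- (n + k%:Z)).
    have X0 : q ^ n * q ^+ k != 0 by rewrite mulf_neq0 ?expfz_neq0 ?expf_neq0.
    by rewrite -invr_expz expfzDr //; apply: (mulIf X0); rewrite mulVf // mulrA.
  exists (if b then - (n + k%:Z) else (n + k%:Z)).
  by case: b E => E; [rewrite -E expr1z|rewrite -[n + _]opprK -invr_expz -E
    -invr_expz expr1z invrK].
split; apply: (qpoch_neq0 q1) => k.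
- by have := key 0 k true; rewrite expr1z expr0z mulr1.
- by have := key 1 k false; rewrite -invr_expz !expr1z (mulrC _ q).
- by have := key (-1) k true; rewrite -invr_expz !expr1z.
- by have := key 2 k false; rewrite -invr_expz !expr1z (mulrC _ (q ^ _)).
Qed.

Lemma qtheta_unit (y : C) : poch_unit q (qpoch q) y -> qtheta q y != 0.
Proof. by move=> [? ? _ _]; rewrite /qtheta /qpoch2 mulf_neq0. Qed.

(** The data enter through equations so that one statement serves both positions and all six
    permuted lists. [T] and [t] collect what stands behind the block. *)
Lemma stilde_entries (M : nat) (b beta : 'I_M -> C) (c gamma : C) (r : nat)
    (hr : (r.+1 < M)%N) (lw x y T t D : C) (n0o n0i n1o n1i A B G : C) :
  let r0 := Ordinal (ltnW hr) in let r1 := Ordinal hr in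
  b r0 = x -> b r1 = y -> tail_prod b r.+2 = T -> tail_sum beta r.+2 = t ->
  c / T = D -> c != 0 -> T != 0 -> x != 0 -> y != 0 ->
  A = powC lw (beta r0) -> B = powC lw (beta r1) -> G = powC lw (gamma - t) ->
  n0o = qpoch q (q * (x * y) / D) / qpoch q (q ^+ 2 * x / D) ->
  n0i = qpoch q (q * (x * y) / D) / qpoch q (q ^+ 2 * y / D) ->
  n1o = qpoch q (q * x / D) / qpoch q (q ^+ 2 / D) ->
  n1i = qpoch q (q * y / D) / qpoch q (q ^+ 2 / D) ->
  poch_unit q (qpoch q) D -> poch_unit q (qpoch q) (D / x) ->
  poch_unit q (qpoch q) (D / y) -> poch_unit q (qpoch q) (D / (x * y)) ->
  qtheta q (expC lw * x) != 0 ->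
  [/\ Stilde00 q b beta c gamma hr lw
      = gauged00 q (qpoch q) (qtheta q) (expC lw) x y D n0o n0i A B G,
      Stilde01 q b beta c hr lw = gauged01 (qtheta q) (expC lw) x y n0o n1i A,
      Stilde10 q b beta c hr lw
      = gauged10 (qtheta q) (expC lw) x y D n1o n0i B
    & Stilde11 q b beta c gamma hr lw
      = gauged11 q (qpoch q) (qtheta q) (expC lw) x y D n1o n1i G].
Proof.
move=> r0 r1 bx by_ bT bt cD c0 T0 x0 y0 -> -> -> -> -> -> -> uD uDx uDy uDxy tw.
have B1 : tail_prod b r.+1 = y * T by rewrite (tail_prodS b hr) by_ bT.
have B0 : tail_prod b r = x * y * T.
  by rewrite (tail_prodS b (ltnW hr)) bx B1 mulrA.
have t0 : tail_sum beta r = beta r0 + beta r1 + t.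
  by rewrite (tail_sumS beta (ltnW hr)) (tail_sumS beta hr) bt addrA.
have D0 : D != 0 by rewrite -cD mulf_neq0 ?invr_eq0.
have cE : c = D * T by rewrite -cD mulfVK.
have w0 := expC_neq0 lw.
have pochE := qpoch_rec q1.
have thE (z : C) : qtheta q z = qpoch q z * qpoch q (q / z) by [].
have thM := qtheta_mulq q1 q0.
split.
- apply: etrans (@gauged00E _ q (qpoch q) (qtheta q) q0 pochE thE thM (expC lw)
    x y D _ _ _ w0 y0 D0 (powC_neq0 _ _) (powC_neq0 _ _) uDx uDy uDxy tw).
  rewrite /Stilde00 /qpoch2 bx by_ B1 bT t0 cE.
  have -> : q ^+ 2 * x * T / (D * T) = q ^+ 2 * x / D by field; rewrite D0 T0.
  have -> : D * T / (q * (y * T)) = D / (q * y) by field; rewrite ?q0 ?y0 ?T0.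
  have -> : expC lw * (D * T) / (q * (y * T)) = expC lw * D / (q * y).
    by field; rewrite ?q0 ?y0 ?T0.
  congr (_ * _).
  have -> : -1 - (beta r0 + beta r1 + t) + gamma
    = -1 + ((gamma - t) + - (beta r0 + beta r1)) by ring.
  by rewrite (powCD lw (-1)) (powCN lw 1) powC1 (powCD lw (gamma - t)) powCN
    (powCD lw (beta r0)).
- apply: etrans (@gauged01E _ q (qpoch q) (qtheta q) (expC lw)
    x y D _ (powC_neq0 _ _) uD uDx uDy tw).
  rewrite /Stilde01 /qpoch2 bx B0 B1 bT cE powCN.
  have -> : q ^+ 2 * T / (D * T) = q ^+ 2 / D by field; rewrite D0 T0.
  have -> : q ^+ 2 * x * T / (D * T) = q ^+ 2 * x / D by field; rewrite D0 T0.
  have -> : q * (x * y * T) / (D * T) = q * (x * y) / D by field; rewrite D0 T0.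
  by have -> : q * (y * T) / (D * T) = q * y / D by field; rewrite D0 T0.
- apply: etrans (@gauged10E _ q (qpoch q) (qtheta q) q0 pochE thE (expC lw)
    x y D _ y0 D0 (powC_neq0 _ _) uD uDx uDy uDxy tw).
  rewrite /Stilde10 /qpoch2 bx by_ B0 B1 bT cE powCN.
  have -> : D * T / (x * y * T) = D / (x * y) by field; rewrite ?T0 ?x0 ?y0.
  have -> : D * T / (q * T) = D / q by field; rewrite ?T0 ?q0.
  have -> : D * T / (x * T) = D / x by field; rewrite ?T0 ?x0.
  by have -> : D * T / (q * (y * T)) = D / (q * y) by field; rewrite ?q0 ?y0 ?T0.
- apply: etrans (@gauged11E _ q (qpoch q) (qtheta q) q0 thE (expC lw)
    x y D _ w0 x0 D0 (powC_neq0 _ _) uD uDx uDy tw).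
  rewrite /Stilde11 /qpoch2 bx by_ B1 bT bt cE.
  have -> : D * T / (x * T) = D / x by field; rewrite ?T0 ?x0.
  have -> : q * (y * T) / (D * T) = q * y / D by field; rewrite D0 T0.
  have -> : expC lw * q * x * T / (D * T) = expC lw * q * x / D.
    by field; rewrite D0 T0.
  congr (_ * _).
  have -> : 1 + t - gamma = 1 + - (gamma - t) by ring.
  by rewrite (powCD lw 1) powC1 powCN.
Qed.

End StildeEntries.

Section StildeMatrix.
Context {R : realType} (M : nat).
Local Notation C := R[i].
Variables (q : C) (b beta : 'I_M -> C) (c gamma : C) (r : nat).
Variables (hr : (r.+1 < M)%N) (lw : C).
Let r0 : 'I_M := Ordinal (ltnW hr).
Let r1 : 'I_M := Ordinal hr.
Let S := Stilde q b beta c gamma hr lw.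

Lemma StildeE i j : S i j =
  if i == r0 then
    if j == r0 then Stilde00 q b beta c gamma hr lw
    else if j == r1 then Stilde01 q b beta c hr lw else 0
  else if i == r1 then
    if j == r0 then Stilde10 q b beta c hr lw
    else if j == r1 then Stilde11 q b beta c gamma hr lw else 0
  else (i == j)%:R.
Proof.
have r01 : (r0 == r1) = false by apply/eqP => -[]; lia.
rewrite mxE -/r0 -/r1.
have [->|i0] := eqVneq i r0; rewrite /= ?r01 /=.
  have [//|j0] := eqVneq j r0; have [//|j1] := eqVneq j r1.
  by [].
have [->|i1] := eqVneq i r1; rewrite /= //.
have [//|j0] := eqVneq j r0; have [//|j1] := eqVneq j r1.
by [].
Qed.

Lemma Stilde_mulE (X : 'M[C]_M) i j : (S *m X) i j =
  if i == r0 then Stilde00 q b beta c gamma hr lw * X r0 j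
    + Stilde01 q b beta c hr lw * X r1 j
  else if i == r1 then Stilde10 q b beta c hr lw * X r0 j
    + Stilde11 q b beta c gamma hr lw * X r1 j
  else X i j.
Proof.
have r10 : (r1 == r0) = false by apply/eqP => -[]; lia.
rewrite mxE; under eq_bigr => k _ do rewrite StildeE.
have [_|i0] := eqVneq i r0.
  rewrite (bigD1 r0) // (bigD1 r1) ?r10 // !eqxx big1 => [|k] /=; first by rewrite
    addr0.
  by move=> /andP[/negbTE -> /negbTE ->]; rewrite mul0r.
have [_|i1] := eqVneq i r1.
  rewrite (bigD1 r0) // (bigD1 r1) ?r10 // !eqxx big1 => [|k] /=; first by rewrite
    addr0.
  by move=> /andP[/negbTE -> /negbTE ->]; rewrite mul0r.
rewrite (bigD1 i) //= eqxx mul1r big1 ?addr0 // => k /negbTE.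
by rewrite eq_sym => ->; rewrite mul0r.
Qed.

End StildeMatrix.

(** * From nine scalar identities to the matrix identity *)

Section MatrixYangBaxter.
Context {R : realType} (M : nat).
Local Notation C := R[i].
Variables (q c gamma : C) (r : nat) (hr0 : (r.+1 < M)%N) (hr : (r.+2 < M)%N).
Variables b1 b2 b3 b4 b5 b6 e1 e2 e3 e4 e5 e6 : 'I_M -> C.
Variables l1 l2 l3 l4 l5 l6 : C.

Local Notation X00 b e h l := (Stilde00 q b e c gamma h l).
Local Notation X01 b e h l := (Stilde01 q b e c h l).
Local Notation X10 b e h l := (Stilde10 q b e c h l).
Local Notation X11 b e h l := (Stilde11 q b e c gamma h l).

(** Outside the 3x3 block at positions r, r+1, r+2 both sides are the identity. Each hypothesis is
    one entry of that block; it has fewer terms or factors where one of the matrices acts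
    trivially. *)
Lemma Stilde_yang_baxter :
  X00 b1 e1 hr0 l1 * X00 b3 e3 hr0 l3
    + X01 b1 e1 hr0 l1 * X00 b2 e2 hr l2 * X10 b3 e3 hr0 l3 = X00 b5 e5 hr0 l5 ->
  X00 b1 e1 hr0 l1 * X01 b3 e3 hr0 l3
    + X01 b1 e1 hr0 l1 * X00 b2 e2 hr l2 * X11 b3 e3 hr0 l3
    = X01 b5 e5 hr0 l5 * X00 b6 e6 hr l6 ->
  X01 b1 e1 hr0 l1 * X01 b2 e2 hr l2 = X01 b5 e5 hr0 l5 * X01 b6 e6 hr l6 ->
  X10 b1 e1 hr0 l1 * X00 b3 e3 hr0 l3
    + X11 b1 e1 hr0 l1 * X00 b2 e2 hr l2 * X10 b3 e3 hr0 l3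
    = X00 b4 e4 hr l4 * X10 b5 e5 hr0 l5 ->
  X10 b1 e1 hr0 l1 * X01 b3 e3 hr0 l3
    + X11 b1 e1 hr0 l1 * X00 b2 e2 hr l2 * X11 b3 e3 hr0 l3
    = X00 b4 e4 hr l4 * X11 b5 e5 hr0 l5 * X00 b6 e6 hr l6
      + X01 b4 e4 hr l4 * X10 b6 e6 hr l6 ->
  X11 b1 e1 hr0 l1 * X01 b2 e2 hr l2
    = X00 b4 e4 hr l4 * X11 b5 e5 hr0 l5 * X01 b6 e6 hr l6
      + X01 b4 e4 hr l4 * X11 b6 e6 hr l6 ->
  X10 b2 e2 hr l2 * X10 b3 e3 hr0 l3 = X10 b4 e4 hr l4 * X10 b5 e5 hr0 l5 ->
  X10 b2 e2 hr l2 * X11 b3 e3 hr0 l3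
    = X10 b4 e4 hr l4 * X11 b5 e5 hr0 l5 * X00 b6 e6 hr l6
      + X11 b4 e4 hr l4 * X10 b6 e6 hr l6 ->
  X11 b2 e2 hr l2
    = X10 b4 e4 hr l4 * X11 b5 e5 hr0 l5 * X01 b6 e6 hr l6
      + X11 b4 e4 hr l4 * X11 b6 e6 hr l6 ->
  Stilde q b1 e1 c gamma hr0 l1 *m Stilde q b2 e2 c gamma hr l2
    *m Stilde q b3 e3 c gamma hr0 l3
  = Stilde q b4 e4 c gamma hr l4 *m Stilde q b5 e5 c gamma hr0 l5
    *m Stilde q b6 e6 c gamma hr l6.
Proof.
move=> H00 H01 H02 H10 H11 H12 H20 H21 H22.
rewrite -!mulmxA; apply/matrixP => i j; rewrite !Stilde_mulE !StildeE.
(* The middle position is the second one of the matrices at r and the first one of those at r+1,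
   with different proofs of its bound. *)
rewrite (bool_irrelevance (ltnW hr) hr0).
move: (X00 b1 e1 hr0 l1) (X01 b1 e1 hr0 l1) (X10 b1 e1 hr0 l1) (X11 b1 e1 hr0 l1)
  (X00 b2 e2 hr l2) (X01 b2 e2 hr l2) (X10 b2 e2 hr l2) (X11 b2 e2 hr l2)
  (X00 b3 e3 hr0 l3) (X01 b3 e3 hr0 l3) (X10 b3 e3 hr0 l3) (X11 b3 e3 hr0 l3)
  (X00 b4 e4 hr l4) (X01 b4 e4 hr l4) (X10 b4 e4 hr l4) (X11 b4 e4 hr l4)
  (X00 b5 e5 hr0 l5) (X01 b5 e5 hr0 l5) (X10 b5 e5 hr0 l5) (X11 b5 e5 hr0 l5)
  (X00 b6 e6 hr l6) (X01 b6 e6 hr l6) (X10 b6 e6 hr l6) (X11 b6 e6 hr l6)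
  H00 H01 H02 H10 H11 H12 H20 H21 H22.
set i0 := Ordinal (ltnW hr0); set i1 := Ordinal hr0; set i2 := Ordinal hr.
have e01 : (i0 == i1) = false by apply/eqP => /(congr1 val) /=; lia.
have e02 : (i0 == i2) = false by apply/eqP => /(congr1 val) /=; lia.
have e12 : (i1 == i2) = false by apply/eqP => /(congr1 val) /=; lia.
move: i0 i1 i2 e01 e02 e12 => i0 i1 i2 e01 e02 e12.
have e10 : (i1 == i0) = false by rewrite eq_sym.
have e20 : (i2 == i0) = false by rewrite eq_sym.
have e21 : (i2 == i1) = false by rewrite eq_sym.
move=> x1 x2 x3 x4 x5 x6 x7 x8 x9 x10 x11 x12 x13 x14 x15 x16 x17 x18 x19 x20.
move=> x21 x22 x23 x24 H00 H01 H02 H10 H11 H12 H20 H21 H22.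
rewrite ?(eqxx, e01, e02, e12, e10, e20, e21) /=.
have [Ei|ni0] := eqVneq i i0; [rewrite ?Ei|have [Ei|ni1] := eqVneq i i1;
  [rewrite ?Ei|have [Ei|ni2] := eqVneq i i2; [rewrite ?Ei|]]].
all: have [Ej|nj0] := eqVneq j i0; [rewrite ?Ej|have [Ej|nj1] := eqVneq j i1;
  [rewrite ?Ej|have [Ej|nj2] := eqVneq j i2; [rewrite ?Ej|]]].
all: rewrite ?(eqxx, e01, e02, e12, e10, e20, e21) /=.
all: rewrite ?(mulr0, mul0r, addr0, add0r, mulr1, mul1r, mulrA) //.
Qed.

End MatrixYangBaxter.

Unset Implicit Arguments.
Theorem mainTheorem3 (R : realType) (q lq : R[i])
    (hq : 0 < `|q| < 1) (hlq : expC lq = q)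
    (M N : nat) (hM : (3 <= M)%N) (hN : (1 <= N)%N)
    (beta b : 'I_M -> R[i]) (gamma c : 'I_N -> R[i])
    (hb : forall i, b i = powC lq (beta i))
    (hc : forall k, c k = powC lq (gamma k))
    (hbc : forall (s : 'S_M) (i : nat) (k : 'I_N), (i <= M)%N ->
       ~ qZ q (c k / tail_prod (fun j => b (s j)) i))
    (k : 'I_N) (r : nat) (hr : (r.+2 < M)%N) :
  let hr0 : (r.+1 < M)%N := ltnW hr in
  let s0 := adj_transp hr0 in
  let s1 := adj_transp hr in
  let S0 (s : 'S_M) (lw : R[i]) :=
    Stilde q (fun i => b (s i)) (fun i => beta (s i)) (c k) (gamma k) hr0 lw in
  let S1 (s : 'S_M) (lw : R[i]) :=
    Stilde q (fun i => b (s i)) (fun i => beta (s i)) (c k) (gamma k) hr lw in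
  (* the identity holds wherever no entry of the six matrices has a vanishing
     denominator: these denominators are theta(u b_{r+1}), theta(uv b_r) and
     theta(v b_r) *)
  forall lu lv : R[i],
    qtheta q (expC lu * b (Ordinal hr0)) != 0 ->
    qtheta q (expC (lu + lv) * b (Ordinal (ltnW hr0))) != 0 ->
    qtheta q (expC lv * b (Ordinal (ltnW hr0))) != 0 ->
  S0 (s1 * s0)%g lu *m S1 s0 (lu + lv) *m S0 1%g lv
  = S1 (s0 * s1)%g lv *m S0 s1 (lu + lv) *m S1 1%g lu.
Proof.
cbv zeta.
set hr0 := ltnW hr; set s0 := adj_transp hr0; set s1 := adj_transp hr.
move=> lu lv.
have /andP[qpos qlt1] := hq.
have q0 : q != 0 by rewrite -normr_gt0.
have q1 : normc q < 1 by move: qlt1; rewrite normcE0 ltcR.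
pose i0 : 'I_M := Ordinal (ltnW hr0); pose i1 : 'I_M := Ordinal hr0.
pose i2 : 'I_M := Ordinal hr.
have n01 : i0 != i1 by apply/eqP => /(congr1 val) /=; lia.
have n02 : i0 != i2 by apply/eqP => /(congr1 val) /=; lia.
have n12 : i1 != i2 by apply/eqP => /(congr1 val) /=; lia.
have s00 : s0 i0 = i1 by exact: tpermL.
have s01 : s0 i1 = i0 by exact: tpermR.
have s02 : s0 i2 = i2 by exact: tpermD.
have s10 : s1 i0 = i0.
  by apply: (@tpermD _ i1 i2); rewrite eq_sym.
have s11 : s1 i1 = i2 by exact: (tpermL i1 i2).
have s12 : s1 i2 = i1 by exact: (tpermR i1 i2).
(* All permutations involved move only the three positions of the block, so the six lists share the
   tail [T] and its exponent sum [t]. *)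
pose far (s : 'S_M) := forall j : 'I_M, (r.+3 <= j)%N -> s j = j.
have far0 : far s0.
  by move=> j rj; apply: tpermD; apply/eqP => /(congr1 val) /=; lia.
have far1 : far s1.
  by move=> j rj; apply: tpermD; apply/eqP => /(congr1 val) /=; lia.
have far_id : far 1%g by move=> j _; rewrite perm1.
have farM (s s' : 'S_M) : far s -> far s' -> far (s * s')%g.
  by move=> f f' j rj; rewrite permM f // f'.
pose x := b i0; pose y := b i1; pose z := b i2.
pose T := tail_prod b r.+3; pose t := tail_sum beta r.+3; pose D : R[i] := c k / T.
have bn0 i : b i != 0 by rewrite hb powC_neq0.
have x0 : x != 0 := bn0 _. have y0 : y != 0 := bn0 _. have z0 : z != 0 := bn0 _.
have c0 : c k != 0 by rewrite hc powC_neq0.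
have T0 : T != 0 by exact: tail_prod_neq0.
have D0 : D != 0 by rewrite mulf_neq0 ?invr_eq0.
have tp3 s : far s -> tail_prod (fun j => b (s j)) r.+3 = T.
  exact: tail_prod_perm.
have tp2 s : far s -> tail_prod (fun j => b (s j)) r.+2 = b (s i2) * T.
  by move=> fs; rewrite (tail_prodS _ hr) tp3.
have tp1 s : far s ->
    tail_prod (fun j => b (s j)) r.+1 = b (s i1) * (b (s i2) * T).
  by move=> fs; rewrite (tail_prodS _ hr0) tp2.
have tp0 s : far s ->
    tail_prod (fun j => b (s j)) r = b (s i0) * (b (s i1) * (b (s i2) * T)).
  by move=> fs; rewrite (tail_prodS _ (ltnW hr0)) tp1.
have ts3 s : far s -> tail_sum (fun j => beta (s j)) r.+3 = t.
  exact: tail_sum_perm.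
have ts2 s : far s -> tail_sum (fun j => beta (s j)) r.+2 = beta (s i2) + t.
  by move=> fs; rewrite (tail_sumS _ hr) ts3.
pose U (X : R[i]) := poch_unit q (qpoch q) X.
have hU (s : 'S_M) i (X : R[i]) : X != 0 -> (i <= M)%N ->
    c k / tail_prod (fun j => b (s j)) i = X -> U X.
  move=> X0 iM E; apply: qpoch_unit => //; rewrite -E.
  exact: (hbc s i k iM).
have nzD (X : R[i]) : X != 0 -> D / X != 0 by move=> X0; rewrite mulf_neq0 ?invr_eq0.
have uD : U D by apply: (hU 1%g r.+3) => //; rewrite tp3.
(* Each quotient of [D] by some of x, y, z is [c k] over a tail of a permuted list; the permutation
   moves these parameters to the end of the triple. *)
have uDx : U (D / x).
  apply: (hU (s1 * s0)%g r.+2); rewrite ?nzD ?(ltnW hr) //.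
  by rewrite tp2 ?permM ?s12 ?s01 /D /x /y /z; [field; rewrite ?T0 ?bn0|exact: farM].
have uDy : U (D / y).
  apply: (hU s1 r.+2); rewrite ?nzD ?(ltnW hr) //.
  by rewrite tp2 ?s12 /D /x /y /z; [field; rewrite ?T0 ?bn0|].
have uDz : U (D / z).
  apply: (hU 1%g r.+2); rewrite ?nzD ?(ltnW hr) //.
  by rewrite tp2 ?perm1 /D /x /y /z; [field; rewrite ?T0 ?bn0|].
have uDxy : U (D / (x * y)).
  apply: (hU (s0 * s1)%g r.+1); rewrite ?nzD ?mulf_neq0 ?(ltnW hr0) //.
  by rewrite tp1 ?permM ?s01 ?s02 ?s10 ?s12 /D /x /y /z; [field; rewrite ?T0
    ?bn0|exact: farM].
have uDxz : U (D / (x * z)).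
  apply: (hU s0 r.+1); rewrite ?nzD ?mulf_neq0 ?(ltnW hr0) //.
  by rewrite tp1 ?s01 ?s02 /D /x /y /z; [field; rewrite ?T0 ?bn0|].
have uDyz : U (D / (y * z)).
  apply: (hU 1%g r.+1); rewrite ?nzD ?mulf_neq0 ?(ltnW hr0) //.
  by rewrite tp1 ?perm1 /D /x /y /z; [field; rewrite ?T0 ?bn0|].
have uDxyz : U (D / (x * y * z)).
  apply: (hU 1%g r); rewrite ?nzD ?mulf_neq0 ?(ltnW (ltnW hr0)) //.
  by rewrite tp0 ?perm1 /D /x /y /z; [field; rewrite ?T0 ?bn0|].
rewrite expCD -/i0 -/i1 -/x -/y => tuy tuvx tvx.
(* [nu B_i B_(i+1)], up to the common tail, is the gauge factor at position i. *)
pose nu (X Y : R[i]) := qpoch q (q * X / D) / qpoch q (q ^+ 2 * Y / D).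
(* The letter names the list and the digit the position: i is (x,y,z), a is (y,x,z), b is (y,z,x), c
   is (x,z,y), d is (z,x,y) and f is (z,y,x). The left side runs through i, a, b, f and the right
   side through i, c, d, f; factors that an exchange leaves unchanged keep their name. *)
pose f0 := nu (x*y*z) (x*y).
pose f1 := nu (x*y) x.
pose f2 := nu x 1.
pose a0 := nu (x*y*z) (x*z).
pose a1 := nu (x*z) z.
pose b1 := nu (x*z) x.
pose i0n := nu (x*y*z) (y*z).
pose i1n := nu (y*z) z.
pose i2n := nu z 1.
pose c1 := nu (y*z) y.
pose c2 := nu y 1.
pose d1 := nu (x*y) y.
pose Ua := powC lu (beta i0).
pose Ub := powC lu (beta i1).
pose Uz := powC lu (beta i2).
pose UG := powC lu (gamma k - t).
pose Va := powC lv (beta i0).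
pose Vb := powC lv (beta i1).
pose Vz := powC lv (beta i2).
pose VG := powC lv (gamma k - t).
have nuE X Y p1 p2 : q * X / D = p1 -> q ^+ 2 * Y / D = p2 ->
    nu X Y = qpoch q p1 / qpoch q p2 by rewrite /nu => -> ->.
(* For a matrix at position r the tail sum also contains the exponent of the third parameter; it is
   split off so that all powers are expressed in the same letters. *)
have powB l g a e : powC l (g - (a + e)) = powC l (g - e) / powC l a :> R[i].
  by rewrite -powCN -powCD; congr (powC _ _); ring.
(* [P], [Q], [R] and [P1], [Q1], [R1] are the factors of the two sides of the
   equation, in the order in which they are written. *)
have [P_00 P_01 P_10 P_11] :
  [/\ Stilde00 q (fun i => b ((s1 * s0)%g i)) (fun i => beta ((s1 * s0)%g i)) (c k)
    (gamma k) hr0 lu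
      = gauged00 q (qpoch q) (qtheta q) (expC lu) y z (D / x) f0 a0 Ub Uz (UG / Ua),
      Stilde01 q (fun i => b ((s1 * s0)%g i)) (fun i => beta ((s1 * s0)%g i)) (c k) hr0
        lu
      = gauged01 (qtheta q) (expC lu) y z f0 b1 Ub,
      Stilde10 q (fun i => b ((s1 * s0)%g i)) (fun i => beta ((s1 * s0)%g i)) (c k) hr0
        lu
      = gauged10 (qtheta q) (expC lu) y z (D / x) f1 a0 Uz
    & Stilde11 q (fun i => b ((s1 * s0)%g i)) (fun i => beta ((s1 * s0)%g i)) (c k)
      (gamma k) hr0 lu
      = gauged11 q (qpoch q) (qtheta q) (expC lu) y z (D / x) f1 b1 (UG / Ua)].
  apply: (@stilde_entries _ q q1 q0 M _ _ _ _ r hr0 lu y z (x * T) (beta i0 + t)).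
  - by rewrite ?permM ?perm1 ?(s00, s01, s02, s10, s11, s12).
  - by rewrite ?permM ?perm1 ?(s00, s01, s02, s10, s11, s12).
  - by rewrite tp2 ?permM ?perm1 ?(s00, s01, s02, s10, s11, s12) //; exact: farM.
  - by rewrite ts2 ?permM ?perm1 ?(s00, s01, s02, s10, s11, s12) //; exact: farM.
  - by rewrite /D; field; rewrite ?T0 ?x0 ?y0 ?z0.
  - exact: c0.
  - exact: (mulf_neq0 x0 T0).
  - exact: y0.
  - exact: z0.
  - by rewrite ?permM ?perm1 ?(s00, s01, s02, s10, s11, s12).
  - by rewrite ?permM ?perm1 ?(s00, s01, s02, s10, s11, s12).
  - by rewrite powB.
  - by apply: nuE; field; rewrite ?x0 ?y0 ?z0 ?D0 //.
  - by apply: nuE; field; rewrite ?x0 ?y0 ?z0 ?D0 //.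
  - by apply: nuE; field; rewrite ?x0 ?y0 ?z0 ?D0 //.
  - by apply: nuE; field; rewrite ?x0 ?y0 ?z0 ?D0 //.
  - exact: uDx.
  - by rewrite [X in poch_unit _ _ X](_ : _ = D / (x * y)) //; field; rewrite ?x0 ?y0
    ?z0 ?D0 //.
  - by rewrite [X in poch_unit _ _ X](_ : _ = D / (x * z)) //; field; rewrite ?x0 ?y0
    ?z0 ?D0 //.
  - by rewrite [X in poch_unit _ _ X](_ : _ = D / (x * y * z)) //; field; rewrite ?x0
    ?y0 ?z0 ?D0 //.
  - by rewrite ?expCD.
have [Q_00 Q_01 Q_10 Q_11] :
  [/\ Stilde00 q (fun i => b (s0 i)) (fun i => beta (s0 i)) (c k) (gamma k) hr (lu + lv)
      = gauged00 q (qpoch q) (qtheta q) ((expC lu * expC lv)) x z D b1 a1 (Ua * Va) (Uz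
        * Vz) (UG * VG),
      Stilde01 q (fun i => b (s0 i)) (fun i => beta (s0 i)) (c k) hr (lu + lv)
      = gauged01 (qtheta q) ((expC lu * expC lv)) x z b1 i2n (Ua * Va),
      Stilde10 q (fun i => b (s0 i)) (fun i => beta (s0 i)) (c k) hr (lu + lv)
      = gauged10 (qtheta q) ((expC lu * expC lv)) x z D f2 a1 (Uz * Vz)
    & Stilde11 q (fun i => b (s0 i)) (fun i => beta (s0 i)) (c k) (gamma k) hr (lu + lv)
      = gauged11 q (qpoch q) (qtheta q) ((expC lu * expC lv)) x z D f2 i2n (UG * VG)].
  rewrite -expCD; apply: (@stilde_entries _ q q1 q0 M _ _ _ _ r.+1 hr (lu + lv) x z T
    t).
  - by rewrite ?permM ?perm1 ?(s00, s01, s02, s10, s11, s12).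
  - by rewrite ?permM ?perm1 ?(s00, s01, s02, s10, s11, s12).
  - by rewrite tp3 ?permM ?perm1 ?(s00, s01, s02, s10, s11, s12) //; exact: far0.
  - by rewrite ts3 ?permM ?perm1 ?(s00, s01, s02, s10, s11, s12) //; exact: far0.
  - by [].
  - exact: c0.
  - exact: T0.
  - exact: x0.
  - exact: z0.
  - by rewrite ?permM ?perm1 ?(s00, s01, s02, s10, s11, s12) ?powC_addl.
  - by rewrite ?permM ?perm1 ?(s00, s01, s02, s10, s11, s12) ?powC_addl.
  - by rewrite  ?powC_addl.
  - by apply: nuE; field; rewrite ?x0 ?y0 ?z0 ?D0 //.
  - by apply: nuE; field; rewrite ?x0 ?y0 ?z0 ?D0 //.
  - by apply: nuE; field; rewrite ?x0 ?y0 ?z0 ?D0 //.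
  - by apply: nuE; field; rewrite ?x0 ?y0 ?z0 ?D0 //.
  - exact: uD.
  - exact: uDx.
  - exact: uDz.
  - exact: uDxz.
  - by rewrite ?expCD.
have [R_00 R_01 R_10 R_11] :
  [/\ Stilde00 q (fun i => b ((1%g : 'S_M) i)) (fun i => beta ((1%g : 'S_M) i)) (c k)
    (gamma k) hr0 lv
      = gauged00 q (qpoch q) (qtheta q) (expC lv) x y (D / z) a0 i0n Va Vb (VG / Vz),
      Stilde01 q (fun i => b ((1%g : 'S_M) i)) (fun i => beta ((1%g : 'S_M) i)) (c k)
        hr0 lv
      = gauged01 (qtheta q) (expC lv) x y a0 i1n Va,
      Stilde10 q (fun i => b ((1%g : 'S_M) i)) (fun i => beta ((1%g : 'S_M) i)) (c k)
        hr0 lv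
      = gauged10 (qtheta q) (expC lv) x y (D / z) a1 i0n Vb
    & Stilde11 q (fun i => b ((1%g : 'S_M) i)) (fun i => beta ((1%g : 'S_M) i)) (c k)
      (gamma k) hr0 lv
      = gauged11 q (qpoch q) (qtheta q) (expC lv) x y (D / z) a1 i1n (VG / Vz)].
  apply: (@stilde_entries _ q q1 q0 M _ _ _ _ r hr0 lv x y (z * T) (beta i2 + t)).
  - by rewrite ?permM ?perm1 ?(s00, s01, s02, s10, s11, s12).
  - by rewrite ?permM ?perm1 ?(s00, s01, s02, s10, s11, s12).
  - by rewrite tp2 ?permM ?perm1 ?(s00, s01, s02, s10, s11, s12) //; exact: far_id.
  - by rewrite ts2 ?permM ?perm1 ?(s00, s01, s02, s10, s11, s12) //; exact: far_id.
  - by rewrite /D; field; rewrite ?T0 ?x0 ?y0 ?z0.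
  - exact: c0.
  - exact: (mulf_neq0 z0 T0).
  - exact: x0.
  - exact: y0.
  - by rewrite ?permM ?perm1 ?(s00, s01, s02, s10, s11, s12).
  - by rewrite ?permM ?perm1 ?(s00, s01, s02, s10, s11, s12).
  - by rewrite powB.
  - by apply: nuE; field; rewrite ?x0 ?y0 ?z0 ?D0 //.
  - by apply: nuE; field; rewrite ?x0 ?y0 ?z0 ?D0 //.
  - by apply: nuE; field; rewrite ?x0 ?y0 ?z0 ?D0 //.
  - by apply: nuE; field; rewrite ?x0 ?y0 ?z0 ?D0 //.
  - exact: uDz.
  - by rewrite [X in poch_unit _ _ X](_ : _ = D / (x * z)) //; field; rewrite ?x0 ?y0
    ?z0 ?D0 //.
  - by rewrite [X in poch_unit _ _ X](_ : _ = D / (y * z)) //; field; rewrite ?x0 ?y0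
    ?z0 ?D0 //.
  - by rewrite [X in poch_unit _ _ X](_ : _ = D / (x * y * z)) //; field; rewrite ?x0
    ?y0 ?z0 ?D0 //.
  - by rewrite ?expCD.
have [P1_00 P1_01 P1_10 P1_11] :
  [/\ Stilde00 q (fun i => b ((s0 * s1)%g i)) (fun i => beta ((s0 * s1)%g i)) (c k)
    (gamma k) hr lv
      = gauged00 q (qpoch q) (qtheta q) (expC lv) x y D f1 d1 Va Vb VG,
      Stilde01 q (fun i => b ((s0 * s1)%g i)) (fun i => beta ((s0 * s1)%g i)) (c k) hr
        lv
      = gauged01 (qtheta q) (expC lv) x y f1 c2 Va,
      Stilde10 q (fun i => b ((s0 * s1)%g i)) (fun i => beta ((s0 * s1)%g i)) (c k) hr
        lv
      = gauged10 (qtheta q) (expC lv) x y D f2 d1 Vb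
    & Stilde11 q (fun i => b ((s0 * s1)%g i)) (fun i => beta ((s0 * s1)%g i)) (c k)
      (gamma k) hr lv
      = gauged11 q (qpoch q) (qtheta q) (expC lv) x y D f2 c2 VG].
  apply: (@stilde_entries _ q q1 q0 M _ _ _ _ r.+1 hr lv x y T t).
  - by rewrite ?permM ?perm1 ?(s00, s01, s02, s10, s11, s12).
  - by rewrite ?permM ?perm1 ?(s00, s01, s02, s10, s11, s12).
  - by rewrite tp3 ?permM ?perm1 ?(s00, s01, s02, s10, s11, s12) //; exact: farM.
  - by rewrite ts3 ?permM ?perm1 ?(s00, s01, s02, s10, s11, s12) //; exact: farM.
  - by [].
  - exact: c0.
  - exact: T0.
  - exact: x0.
  - exact: y0.
  - by rewrite ?permM ?perm1 ?(s00, s01, s02, s10, s11, s12).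
  - by rewrite ?permM ?perm1 ?(s00, s01, s02, s10, s11, s12).
  - by [].
  - by apply: nuE; field; rewrite ?x0 ?y0 ?z0 ?D0 //.
  - by apply: nuE; field; rewrite ?x0 ?y0 ?z0 ?D0 //.
  - by apply: nuE; field; rewrite ?x0 ?y0 ?z0 ?D0 //.
  - by apply: nuE; field; rewrite ?x0 ?y0 ?z0 ?D0 //.
  - exact: uD.
  - exact: uDx.
  - exact: uDy.
  - exact: uDxy.
  - by rewrite ?expCD.
have [Q1_00 Q1_01 Q1_10 Q1_11] :
  [/\ Stilde00 q (fun i => b (s1 i)) (fun i => beta (s1 i)) (c k) (gamma k) hr0 (lu +
    lv)
      = gauged00 q (qpoch q) (qtheta q) ((expC lu * expC lv)) x z (D / y) f0 i0n (Ua *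
        Va) (Uz * Vz) (UG * VG / (Ub * Vb)),
      Stilde01 q (fun i => b (s1 i)) (fun i => beta (s1 i)) (c k) hr0 (lu + lv)
      = gauged01 (qtheta q) ((expC lu * expC lv)) x z f0 c1 (Ua * Va),
      Stilde10 q (fun i => b (s1 i)) (fun i => beta (s1 i)) (c k) hr0 (lu + lv)
      = gauged10 (qtheta q) ((expC lu * expC lv)) x z (D / y) d1 i0n (Uz * Vz)
    & Stilde11 q (fun i => b (s1 i)) (fun i => beta (s1 i)) (c k) (gamma k) hr0 (lu +
      lv)
      = gauged11 q (qpoch q) (qtheta q) ((expC lu * expC lv)) x z (D / y) d1 c1 (UG *
        VG / (Ub * Vb))].
  rewrite -expCD; apply: (@stilde_entries _ q q1 q0 M _ _ _ _ r hr0 (lu + lv) x z (y *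
    T) (beta i1 + t)).
  - by rewrite ?permM ?perm1 ?(s00, s01, s02, s10, s11, s12).
  - by rewrite ?permM ?perm1 ?(s00, s01, s02, s10, s11, s12).
  - by rewrite tp2 ?permM ?perm1 ?(s00, s01, s02, s10, s11, s12) //; exact: far1.
  - by rewrite ts2 ?permM ?perm1 ?(s00, s01, s02, s10, s11, s12) //; exact: far1.
  - by rewrite /D; field; rewrite ?T0 ?x0 ?y0 ?z0.
  - exact: c0.
  - exact: (mulf_neq0 y0 T0).
  - exact: x0.
  - exact: z0.
  - by rewrite ?permM ?perm1 ?(s00, s01, s02, s10, s11, s12) ?powC_addl.
  - by rewrite ?permM ?perm1 ?(s00, s01, s02, s10, s11, s12) ?powC_addl.
  - by rewrite powB ?powC_addl.
  - by apply: nuE; field; rewrite ?x0 ?y0 ?z0 ?D0 //.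
  - by apply: nuE; field; rewrite ?x0 ?y0 ?z0 ?D0 //.
  - by apply: nuE; field; rewrite ?x0 ?y0 ?z0 ?D0 //.
  - by apply: nuE; field; rewrite ?x0 ?y0 ?z0 ?D0 //.
  - exact: uDy.
  - by rewrite [X in poch_unit _ _ X](_ : _ = D / (x * y)) //; field; rewrite ?x0 ?y0
    ?z0 ?D0 //.
  - by rewrite [X in poch_unit _ _ X](_ : _ = D / (y * z)) //; field; rewrite ?x0 ?y0
    ?z0 ?D0 //.
  - by rewrite [X in poch_unit _ _ X](_ : _ = D / (x * y * z)) //; field; rewrite ?x0
    ?y0 ?z0 ?D0 //.
  - by rewrite ?expCD.
have [R1_00 R1_01 R1_10 R1_11] :
  [/\ Stilde00 q (fun i => b ((1%g : 'S_M) i)) (fun i => beta ((1%g : 'S_M) i)) (c k)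
    (gamma k) hr lu
      = gauged00 q (qpoch q) (qtheta q) (expC lu) y z D c1 i1n Ub Uz UG,
      Stilde01 q (fun i => b ((1%g : 'S_M) i)) (fun i => beta ((1%g : 'S_M) i)) (c k)
        hr lu
      = gauged01 (qtheta q) (expC lu) y z c1 i2n Ub,
      Stilde10 q (fun i => b ((1%g : 'S_M) i)) (fun i => beta ((1%g : 'S_M) i)) (c k)
        hr lu
      = gauged10 (qtheta q) (expC lu) y z D c2 i1n Uz
    & Stilde11 q (fun i => b ((1%g : 'S_M) i)) (fun i => beta ((1%g : 'S_M) i)) (c k)
      (gamma k) hr lu
      = gauged11 q (qpoch q) (qtheta q) (expC lu) y z D c2 i2n UG].
  apply: (@stilde_entries _ q q1 q0 M _ _ _ _ r.+1 hr lu y z T t).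
  - by rewrite ?permM ?perm1 ?(s00, s01, s02, s10, s11, s12).
  - by rewrite ?permM ?perm1 ?(s00, s01, s02, s10, s11, s12).
  - by rewrite tp3 ?permM ?perm1 ?(s00, s01, s02, s10, s11, s12) //; exact: far_id.
  - by rewrite ts3 ?permM ?perm1 ?(s00, s01, s02, s10, s11, s12) //; exact: far_id.
  - by [].
  - exact: c0.
  - exact: T0.
  - exact: y0.
  - exact: z0.
  - by rewrite ?permM ?perm1 ?(s00, s01, s02, s10, s11, s12).
  - by rewrite ?permM ?perm1 ?(s00, s01, s02, s10, s11, s12).
  - by [].
  - by apply: nuE; field; rewrite ?x0 ?y0 ?z0 ?D0 //.
  - by apply: nuE; field; rewrite ?x0 ?y0 ?z0 ?D0 //.
  - by apply: nuE; field; rewrite ?x0 ?y0 ?z0 ?D0 //.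
  - by apply: nuE; field; rewrite ?x0 ?y0 ?z0 ?D0 //.
  - exact: uD.
  - exact: uDy.
  - exact: uDz.
  - exact: uDyz.
  - by rewrite ?expCD.
have nu_neq0 (X Y : R[i]) : U (D / X) -> U (D / Y) -> nu X Y != 0.
  move=> [_ + _ _] [_ _ _ +]; rewrite !(invf_div D) !mulrA => H1 H2.
  exact: mulf_neq0 H1 (invr_neq0 H2).
have uD1 : U (D / 1) by rewrite divr1.
have nf0 : f0 != 0 := nu_neq0 _ _ uDxyz uDxy.
have nf1 : f1 != 0 := nu_neq0 _ _ uDxy uDx.
have nf2 : f2 != 0 := nu_neq0 _ _ uDx uD1.
have na0 : a0 != 0 := nu_neq0 _ _ uDxyz uDxz.
have na1 : a1 != 0 := nu_neq0 _ _ uDxz uDz.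
have nb1 : b1 != 0 := nu_neq0 _ _ uDxz uDx.
have ni0n : i0n != 0 := nu_neq0 _ _ uDxyz uDyz.
have ni1n : i1n != 0 := nu_neq0 _ _ uDyz uDz.
have ni2n : i2n != 0 := nu_neq0 _ _ uDz uD1.
have nc1 : c1 != 0 := nu_neq0 _ _ uDyz uDy.
have nc2 : c2 != 0 := nu_neq0 _ _ uDy uD1.
have nd1 : d1 != 0 := nu_neq0 _ _ uDxy uDy.
have nUa : Ua != 0 := powC_neq0 _ _.
have nUb : Ub != 0 := powC_neq0 _ _.
have nUz : Uz != 0 := powC_neq0 _ _.
have nUG : UG != 0 := powC_neq0 _ _.
have nVa : Va != 0 := powC_neq0 _ _.
have nVb : Vb != 0 := powC_neq0 _ _.
have nVz : Vz != 0 := powC_neq0 _ _.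
have nVG : VG != 0 := powC_neq0 _ _.
have u0 : expC lu != 0 := expC_neq0 _. have v0 : expC lv != 0 := expC_neq0 _.
have [tDx tDy tDz] : [/\ qtheta q (D / x) != 0, qtheta q (D / y) != 0
  & qtheta q (D / z) != 0] by split; exact: qtheta_unit.
have [tDxy tDxz tDyz] : [/\ qtheta q (D / (x * y)) != 0, qtheta q (D / (x * z)) != 0
  & qtheta q (D / (y * z)) != 0] by split; exact: qtheta_unit.
have thE X : qtheta q X = qpoch q X * qpoch q (q / X) by [].
have thV := qtheta_inv q1 q0.
have thW := weierstrass_three_term q1 q0.
apply: Stilde_yang_baxter.
- rewrite P_00 P_01 Q_00 R_00 R_10 Q1_00.
  by apply: (@gauged_ybe00 _ q (qpoch q) (qtheta q) thE thV thW).
- rewrite P_00 P_01 Q_00 R_01 R_11 Q1_01 R1_00.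
  by apply: (@gauged_ybe01 _ q (qpoch q) (qtheta q) thE thV thW).
- rewrite P_01 Q_01 Q1_01 R1_01.
  by apply: (@gauged_ybe02 _ (qtheta q)).
- rewrite P_10 P_11 Q_00 R_00 R_10 P1_00 Q1_10.
  by apply: (@gauged_ybe10 _ q (qpoch q) (qtheta q) thE thV thW).
- rewrite P_10 P_11 Q_00 R_01 R_11 P1_00 P1_01 Q1_11 R1_00 R1_10.
  by apply: (@gauged_ybe11 _ q (qpoch q) (qtheta q) thE thV thW).
- rewrite P_11 Q_01 P1_00 P1_01 Q1_11 R1_01 R1_11.
  by apply: (@gauged_ybe12 _ q (qpoch q) (qtheta q) thE thV thW).
- rewrite Q_10 R_10 P1_10 Q1_10.
  by apply: (@gauged_ybe20 _ (qtheta q)).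
- rewrite Q_10 R_11 P1_10 P1_11 Q1_11 R1_00 R1_10.
  by apply: (@gauged_ybe21 _ q (qpoch q) (qtheta q) thE thV thW).
- rewrite Q_11 P1_10 P1_11 Q1_11 R1_01 R1_11.
  by apply: (@gauged_ybe22 _ q (qpoch q) (qtheta q) thE thV thW).
Qed.
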